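(* Let the coefficients $b,\sigma$ satisfy the Lipschitz assumption stated in the context, let $h>0$ be fixed, and let $(\Omega,\mathcal F,\mathbb P)$ be a probability space. (i) For every $N\ge 1$ and every input $(\vec\zeta^N,\vec W^N)=(\zeta^{i,N},W^{i,N})_{1\le i\le N}\in L^p_{\mathbb P}(\Omega,(\mathbb R^d\times\mathcal C^{d'})^N)$, there exists a pathwise unique strong solution $\vec X^{h,N}=(X^{h,i,N})_{1\le i\le N}$ of the discretised particle system with this input. (ii) For every input $(\zeta,W)\in L^p_{\mathbb P}(\Omega,\mathbb R^d\times\mathcal C^{d'})$ there exists a unique pathwise solution $X^h$ of the discretised McKean-Vlasov equation with this input, and the map $$\Psi_h:\mathcal P_p(\mathbb R^d\times\mathcal C^{d'})\to\mathcal P_p(\mathcal C^d),\qquad \mathcal L(\zeta,W)\mapsto\mathcal L(X^h),$$ is continuous. (iii) $\mathbb P$-almost surely, $\pi(\vec X^{h,N})=\Psi_h(\pi(\vec\zeta^N,\vec W^N))$.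
   Context: Fix $T>0$, integers $d,d'\ge1$ and $p\ge1$. For $k\ge 1$, $\mathcal C^k:=C([0,T],\mathbb R^k)$ with the sup norm. For a Polish space $E$ with distance $d_E$, $\mathcal P_p(E)$ is the set of probability measures on $E$ with finite $p$-th moment, endowed with the Wasserstein distance $W_p$; $L^p_{\mathbb P}(\Omega,E)$ is the set of $E$-valued random variables whose law is in $\mathcal P_p(E)$; $\mathcal L(X)$ denotes the law of $X$. For $x\in\mathcal C^d$, $x_{\wedge t}:=(x_{s\wedge t})_{0\le s\le T}$, and for $P\in\mathcal P_p(\mathcal C^d)$, $P_{\wedge t}$ is the push-forward of $P$ by $x\mapsto x_{\wedge t}$. Empirical measures: $\pi(\vec x^N):=\frac1N\sum_{i=1}^N\delta_{x^i}$ and $\pi(\vec x^N,\vec y^N):=\frac1N\sum_{i=1}^N\delta_{(x^i,y^i)}$. Coefficients: continuous functions $b:[0,T]\times\mathcal C^d\times\mathcal P_p(\mathcal C^d)\to\mathbb R^d$ and $\sigma:[0,T]\times\mathcal C^d\times\mathcal P_p(\mathcal C^d)\to\mathbb R^{d\times d'}$. Lipschitz assumption: there are $L_b,L_\sigma>0$ and functions $\overline b,\overline\sigma$ (same domains and codomains as $b$, $\sigma$), globally $L_b$- and $L_\sigma$-Lipschitz respectively, such that $b_t(x,P)=\overline b_t(x_{\wedge t},P_{\wedge t})$ and $\sigma_t(x,P)=\overline\sigma_t(x_{\wedge t},P_{\wedge t})$ for all $(t,x,P)$; moreover $\sigma$ is globally bounded by some $M_\sigma>0$. Discretised equations: $t_h:=h\lfloor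 t/h\rfloor$. For $P\in\mathcal P_p(\mathcal C^d)$, $(\zeta,w)\in\mathbb R^d\times\mathcal C^{d'}$, $x\in\mathcal C^d$, define $f^{h,P}(\zeta,w,x)\in\mathcal C^d$ by $$f^{h,P}_t(\zeta,w,x)=\zeta+(t-t_h)b_{t_h}(x,P)+\sigma_{t_h}(x,P)[w_t-w_{t_h}]+\sum_{i=0}^{\lfloor t/h\rfloor-1}\big(h\,b_{ih}(x,P)+\sigma_{ih}(x,P)[w_{(i+1)h}-w_{ih}]\big),$$ an empty sum being $0$. A pathwise solution of the discretised McKean-Vlasov equation with input $(\zeta,W)\in L^p_{\mathbb P}(\Omega,\mathbb R^d\times\mathcal C^{d'})$ is $X^h\in L^p_{\mathbb P}(\Omega,\mathcal C^d)$ such that for $\mathbb P$-a.e. $\omega$, for all $t\in[0,T]$, $X^h_t(\omega)=f_t^{h,\mathcal L(X^h)}(\zeta(\omega),W(\omega),X^h(\omega))$. A solution of the discretised particle system with input $(\vec\zeta^N,\vec W^N)$ is a family of random paths $(X^{h,i,N})_{1\le i\le N}$ such that $\mathbb P$-a.s., for all $1\le i\le N$ and $t\in[0,T]$, $X^{h,i,N}_t=f_t^{h,\pi(\vec X^{h,N})}(\zeta^{i,N},W^{i,N},X^{h,i,N})$. No independence or exchangeability of the inputs is required, and the noises are arbitrary continuous random paths. Uniqueness is up to $\mathbb P$-null sets. *)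

(* Defs.v *)
From HB Require Import structures.
From mathcomp Require Import all_boot all_order all_algebra.
From mathcomp Require Import all_classical all_reals all_analysis.
From mathcomp Require Import measurable_realfun giry lra.
Set Implicit Arguments.
Unset Strict Implicit.
Unset Printing Implicit Defensive.
Import Order.TTheory GRing.Theory Num.Theory.
Import numFieldNormedType.Exports.
Local Open Scope classical_set_scope.
Local Open Scope ring_scope.

(* Pointedness is only needed because [measurableType] requires it. *)
#[short(type="pmetricType")]
HB.structure Definition PointedMetric (K : numDomainType) :=
  { M of Metric K M & Pointed M }.

HB.instance Definition _ (R : realType) := Metric.copy R R^o.

(* The product distance on E1 * E2 is the max of the two distances, matching
   the library's balls on pairs. *)
Section prod_metric.
Context {R : realType} (E F : pmetricType R).

Let dist (x y : E * F) : R := Num.max (mdist x.1 y.1) (mdist x.2 y.2).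

Let dist_ge0 x y : 0 <= dist x y.
Proof. by rewrite /dist le_max mdist_ge0. Qed.

Let dist_positivity x y : dist x y = 0 -> x = y.
Proof.
move=> xy0; have h1 : mdist x.1 y.1 <= 0 by rewrite -xy0 /dist le_max lexx.
have h2 : mdist x.2 y.2 <= 0 by rewrite -xy0 /dist le_max lexx orbT.
have e1 : mdist x.1 y.1 = 0 by apply/eqP; rewrite eq_le h1 mdist_ge0.
have e2 : mdist x.2 y.2 = 0 by apply/eqP; rewrite eq_le h2 mdist_ge0.
by case: x y e1 e2 {xy0 h1 h2} => [x1 x2] [y1 y2] /= /mdist_positivity ->
  /mdist_positivity ->.
Qed.

Let dist_ball x e : ball x e = [set y | dist x y < e].
Proof.
apply/seteqP; split => y /=; rewrite /dist gt_max.
- by move=> [] /=; rewrite !ballEmdist /= => -> ->.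
- by move=> /andP[h1 h2]; split; rewrite ballEmdist.
Qed.

HB.instance Definition _ := PseudoMetric_isMetric.Build R (E * F)%type
  dist_ge0 dist_positivity dist_ball.

End prod_metric.

(* The distance on m x n matrices with entries in E is the max over entries.
   For E := R this is the norm distance on R^k and R^(d x d'), see
   [mdist_mxE]; 'rV[E]_N is used for the metric power E^N. *)
Section mx_metric.
Context {R : realType} (E : pmetricType R) (m n : nat).

Let dist (x y : 'M[E]_(m, n)) : R :=
  \big[Num.max/0]_(ij : 'I_m * 'I_n) mdist (x ij.1 ij.2) (y ij.1 ij.2).

Let dist_ge0 x y : 0 <= dist x y.
Proof. exact: bigmax_ge_id. Qed.

Let dist_positivity x y : dist x y = 0 -> x = y.
Proof.
move=> xy0; apply/matrixP => i j; apply: mdist_positivity.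
apply/eqP; rewrite eq_le mdist_ge0 andbT -xy0.
exact: (le_bigmax _ (fun ij => mdist (x ij.1 ij.2) (y ij.1 ij.2)) (i, j)).
Qed.

Let dist_ball x e : ball x e = [set y | dist x y < e].
Proof.
apply/seteqP; split => y /=.
- move=> [e0 xy]; apply/bigmax_ltP; split => // ij _.
  by have := xy ij.1 ij.2; rewrite ballEmdist.
- move=> /bigmax_ltP[e0 xy]; split => // i j.
  by rewrite ballEmdist /=; exact: (xy (i, j)).
Qed.

HB.instance Definition _ := PseudoMetric_isMetric.Build R 'M[E]_(m, n)
  dist_ge0 dist_positivity dist_ball.

End mx_metric.

Lemma mdist_mxE (R : realType) (m n : nat) (x y : 'M[R]_(m, n)) :
  mdist x y = `|y - x|.
Proof.
rewrite /Num.norm /= mx_normrE; apply: eq_bigr => ij _.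
by rewrite !mxE.
Qed.

Lemma ler_dist_minl (R : realDomainType) (a b c : R) :
  `|Num.min a c - Num.min b c| <= `|a - b|.
Proof.
case: (lerP a c) => ac; case: (lerP b c) => bc;
  rewrite ler_norml; case: (lerP b a) => ab; apply/andP; split; lra.
Qed.

Lemma minl_continuous (R : realType) (c : R) :
  continuous (fun a : R => Num.min a c).
Proof.
move=> a; apply/cvgrPdist_lt => e e0; near=> y.
apply: (le_lt_trans (ler_dist_minl _ _ _)).
by near: y; exact: cvgr_dist_lt.
Unshelve. all: by end_near. Qed.

Section paths.
Context {R : realType} (T : {posnum R}).

Definition time := set_type `[0, T%:num].

Lemma clamp_subproof (r : R) :
  Num.max 0 (Num.min r T%:num) \in `[0, T%:num]%classic.
Proof.
by rewrite inE /= in_itv /= le_max lexx /= ge_max ge_min lexx orbT andbT.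
Qed.

(* Nearest point of [0, T], used to evaluate paths at real times. *)
Definition clamp (r : R) : time := SigSub (clamp_subproof r).

Lemma time_itv (t : time) : 0 <= set_val t <= T%:num.
Proof. by have := set_valP t; rewrite /= in_itv. Qed.

Lemma clampK (t : time) : clamp (set_val t) = t.
Proof.
apply: val_inj => /=; have /andP[t0 tT] := time_itv t.
by rewrite (min_idPl tT) (max_idPr t0).
Qed.

Lemma clamp_continuous : continuous clamp.
Proof.
apply/continuous_comp_initial => x /=.
apply/cvgrPdist_lt => e e0; near=> y.
apply: (@le_lt_trans _ _ `|x - y|); last by near: y; exact: cvgr_dist_lt.
have max_lip (a b : R) : `|Num.max 0 a - Num.max 0 b| <= `|a - b|.
  case: (lerP 0 a) => a0; case: (lerP 0 b) => b0;
    rewrite ler_norml; case: (lerP b a) => ab; apply/andP; split; lra.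
exact: le_trans (max_lip _ _) (ler_dist_minl _ _ _).
Unshelve. all: by end_near. Qed.

Definition Cpath (k : nat) := continuousType time 'cV[R]_k.

End paths.

Section path_metric.
Context {R : realType} (T : {posnum R}) (k : nat).
Local Notation C := (Cpath T k).

HB.instance Definition _ := Choice.on C.
HB.instance Definition _ :=
  isPointed.Build C (cst 0 : continuousType (time T) 'cV[R]_k).

Let dist (x y : C) : R := sup (range (fun t : time T => `|x t - y t|)).

Lemma path_dist_ubound (x y : C) :
  has_ubound (range (fun t : time T => `|x t - y t|)).
Proof.
have cxy : continuous (fun r : R => `|x (clamp T r) - y (clamp T r)|).
  move=> r; apply: cvg_norm; apply: cvgB.
    by apply: (continuous_comp (@clamp_continuous _ T r)); exact: cts_fun.
  by apply: (continuous_comp (@clamp_continuous _ T r)); exact: cts_fun.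
have T0 : 0 <= T%:num by [].
have [c _ cmax] := EVT_max T0 (continuous_subspaceT cxy).
exists `|x (clamp T c) - y (clamp T c)| => _ [t _ <-].
have := cmax (set_val t); rewrite clampK; apply.
by rewrite in_itv /= time_itv.
Qed.

Let dist_ub (x y : C) (t : time T) : `|x t - y t| <= dist x y.
Proof. by apply: ub_le_sup; [exact: path_dist_ubound|exists t]. Qed.

Let le_dist (x y : C) (a : R) :
  (forall t : time T, `|x t - y t| <= a) -> dist x y <= a.
Proof.
move=> xya; apply: ge_sup.
  by exists `|x (clamp T 0) - y (clamp T 0)|; exists (clamp T 0).
by move=> _ [t _ <-].
Qed.

Let dist_ge0 x y : 0 <= dist x y.
Proof. by apply: le_trans (dist_ub x y (clamp T 0)). Qed.

Let dist_xx x : dist x x = 0.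
Proof.
apply/eqP; rewrite eq_le dist_ge0 andbT; apply: le_dist => t.
by rewrite subrr normr0.
Qed.

Let dist_positivity x y : dist x y = 0 -> x = y.
Proof.
move=> xy0; apply/continuousEP => t; apply/eqP.
by have := dist_ub x y t; rewrite xy0 normr_le0 subr_eq0.
Qed.

Let dist_sym x y : dist x y = dist y x.
Proof.
by congr sup; congr image; apply/funext => t; rewrite distrC.
Qed.

Let dist_triangle y x z : dist x z <= dist x y + dist y z.
Proof.
apply: le_dist => t; apply: (le_trans (ler_distD (y t) _ _)).
by apply: lerD.
Qed.

HB.instance Definition _ := isMetric.Build R C
  dist_xx dist_positivity dist_sym dist_triangle.

Lemma path_mdistE (x y : C) :
  mdist x y = sup (range (fun t : time T => `|x t - y t|)).
Proof. by []. Qed.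

Lemma path_mdist_le (x y : C) (t : time T) : `|x t - y t| <= mdist x y.
Proof. exact: dist_ub. Qed.

Lemma path_mdist_ge (x y : C) (a : R) :
  (forall t : time T, `|x t - y t| <= a) -> mdist x y <= a.
Proof. exact: le_dist. Qed.

Definition stop_fun (t : time T) (x : C) (s : time T) : 'cV[R]_k :=
  x (clamp T (Num.min (set_val s) (set_val t))).

Lemma stop_fun_continuous (t : time T) (x : C) : continuous (stop_fun t x).
Proof.
move=> s; apply: (@continuous_comp _ _ _
  (clamp T \o Num.min ^~ (set_val t) \o set_val) x); last exact: cts_fun.
apply: (@continuous_comp _ _ _ (set_val : time T -> R)).
  exact: initial_continuous.
apply: continuous_comp; last exact: clamp_continuous.
exact: minl_continuous.
Qed.

HB.instance Definition _ (t : time T) (x : C) :=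
  isContinuous.Build _ _ (stop_fun t x) (@stop_fun_continuous t x).

(* The stopped path of x at time t, s |-> x (min s t). *)
Definition stop (t : time T) (x : C) : C := stop_fun t x.

Lemma mdist_stop (t : time T) (x y : C) :
  mdist (stop t x) (stop t y) <= mdist x y.
Proof.
apply: path_mdist_ge => s.
exact: (path_mdist_le x y (clamp T (Num.min (set_val s) (set_val t)))).
Qed.

End path_metric.

(* The Borel sigma-algebra. *)
Notation borel E := (g_sigma_algebraType (@open E)).

Section wasserstein.
Context {R : realType}.
Implicit Types (p : R) (E F : pmetricType R).

Lemma measurable_mdist_powR p E (x0 : E) :
  @measurable_fun _ _ (borel E) (\bar R) setT
    (fun x => (mdist x0 x `^ p)%:E).
Proof.
apply/measurable_EFinP.
apply: (measurableT_comp (measurable_powR p)).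
apply: (measurability _ (RGenInftyO.measurableE R)) => _ [_ [r ->] <-].
rewrite setTI; apply: sub_gen_smallest => /=.
rewrite openE => x /=; rewrite in_itv /= => xr.
apply/nbhs_ballP; exists (r - mdist x0 x) => /=; first by rewrite subr_gt0.
move=> y; rewrite ballEmdist /= in_itv /= => xy.
by apply: le_lt_trans (metric_triangle x0 x y) _; rewrite -ltrBrDl.
Qed.

Definition finite_moment p E (P : probability (borel E) R) : Prop :=
  exists x0 : E, (\int[P]_x (mdist x0 x `^ p)%:E < +oo)%E.

(* The set P_p(E).  Its elements are identified when they agree on Borel sets,
   i.e. up to [measure_eq], since a library measure is a function on all sets. *)
Record Pp p E := MkPp {
  Pp_prob :> probability (borel E) R;
  Pp_moment : finite_moment p Pp_prob }.

(* L^p(Omega, E). *)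
Record Lp d (Omega : measurableType d) (Pr : probability Omega R) p E := MkLp {
  Lp_rv :> {mfun Omega >-> borel E};
  Lp_moment : finite_moment p (distribution Pr Lp_rv) }.

Definition law d (Omega : measurableType d) (Pr : probability Omega R) p E
  (X : Lp Pr p E) : Pp p E := MkPp (Lp_moment X).

Definition couplings E (P Q : probability (borel E) R) :
    set (probability (borel (E * E)%type) R) :=
  [set g | forall A : set (borel E), measurable A ->
     g (fst @^-1` A) = P A /\ g (snd @^-1` A) = Q A].

(* The p-Wasserstein distance, kept in the extended reals so that no junk value
   can be produced by a projection to R. *)
Definition Wasserstein p E (P Q : Pp p E) : \bar R :=
  (ereal_inf [set \int[g]_z (mdist z.1 z.2 `^ p)%:E | g in couplings P Q]
     `^ p^-1)%E.

Definition Wasserstein_continuous p E F (Psi : Pp p E -> Pp p F) : Prop :=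
  forall P (eps : R), 0 < eps -> exists2 delta : R, 0 < delta &
    forall Q, (Wasserstein P Q < delta%:E)%E ->
      (Wasserstein (Psi P) (Psi Q) < eps%:E)%E.

Section empirical.
Context (p : R) (E : pmetricType R) (N : nat) (x : 'I_N.+1 -> E).

Definition empirical_measure : {measure set (borel E) -> \bar R} :=
  mscale (N.+1%:R^-1)%:nng
    (msum (fun i => \d_(x (inord i) : borel E)) N.+1).

Definition empirical_fun : set (borel E) -> \bar R := empirical_measure.

HB.instance Definition _ := Measure.on empirical_fun.

Lemma empirical_funT : empirical_fun setT = 1%E.
Proof.
rewrite /empirical_fun /empirical_measure /= /mscale /= /msum.
under eq_bigr do rewrite /= diracT.
by rewrite sumEFin /= -EFinM sumr_const card_ord mulVf ?pnatr_eq0.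
Qed.

HB.instance Definition _ :=
  Measure_isProbability.Build _ _ _ empirical_fun empirical_funT.

Lemma empirical_moment : finite_moment p empirical_fun.
Proof.
exists point; rewrite /empirical_fun /empirical_measure.
rewrite ge0_integral_mscale//; last first.
- by move=> y _; rewrite lee_fin powR_ge0.
- exact: measurable_mdist_powR.
rewrite ge0_integral_measure_sum//; last first.
- exact: measurable_mdist_powR.
- by move=> y _; rewrite lee_fin powR_ge0.
under eq_bigr => i _.
  rewrite /= integral_dirac//; last exact: measurable_mdist_powR.
  rewrite diracT mul1e; over.
by rewrite sumEFin -EFinM ltry.
Qed.

(* The empirical measure of N + 1 points; indexing by 'I_N.+1 excludes the
   empty family. *)
Definition empirical : Pp p E := MkPp empirical_moment.

Lemma empiricalE (A : set (borel E)) :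
  empirical A =
    ((N.+1%:R^-1)%:E * \sum_(i < N.+1) \d_(x i : borel E) A)%E.
Proof.
rewrite /empirical /= /empirical_fun /empirical_measure /= /mscale /= /msum.
by congr (_ * _)%E; apply: eq_bigr => i _; rewrite inord_val.
Qed.

End empirical.

End wasserstein.

Section coefficients.
Context {R : realType} (T : {posnum R}) (p : R) (p1 : 1 <= p).
Local Notation C := (Cpath T).

Section stopped_law.
Context (k : nat) (t : time T).

Definition stop_borel : borel (C k) -> borel (C k) := stop t.

Lemma measurable_stop : measurable_fun setT stop_borel.
Proof.
apply: (@measurability _ _ (borel (C k)) (borel (C k)) setT stop_borel
  (@open (C k))) => // _ [U oU <-].
rewrite setTI; apply: sub_gen_smallest => /=.
rewrite openE => x /= Ux.
have /nbhs_ballP[e /= e0 eU] : nbhs (stop t x) U by exact: open_nbhs_nbhs.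
apply/nbhs_ballP; exists e => // y; rewrite ballEmdist /= => xy.
by apply: eU; rewrite ballEmdist /=; exact: le_lt_trans (mdist_stop t x y) xy.
Qed.

HB.instance Definition _ :=
  isMeasurableFun.Build _ _ _ _ stop_borel measurable_stop.

Lemma stopped_moment (P : Pp p (C k)) :
  finite_moment p (distribution P stop_borel).
Proof.
have [x0 Px0] := Pp_moment P; exists (stop t x0).
have m0 (z : C k) : @measurable_fun _ _ (borel (C k)) (\bar R) setT
    (fun x => (mdist z x `^ p)%:E) by exact: measurable_mdist_powR.
have f0 (y : borel (C k)) : (0 <= (mdist (stop t x0) y `^ p)%:E)%E.
  by rewrite lee_fin powR_ge0.
pose f : {mfun borel (C k) >-> borel (C k)} := stop_borel.
have E := @ge0_integral_distribution _ _ _ _ R P f _ (m0 (stop t x0)) f0.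
rewrite E {E}.
apply: le_lt_trans Px0; apply: ge0_le_integral.
- exact: measurableT.
- by move=> x _; rewrite lee_fin powR_ge0.
- exact: (measurableT_comp (m0 (stop t x0)) measurable_stop).
- exact: (m0 x0).
- move=> x _; rewrite lee_fin; apply: ge0_ler_powR.
  + exact: le_trans p1.
  + by rewrite nnegrE mdist_ge0.
  + by rewrite nnegrE mdist_ge0.
  + exact: mdist_stop.
Qed.

(* The push-forward of P by x |-> stop t x. *)
Definition stop_law (P : Pp p (C k)) : Pp p (C k) := MkPp (stopped_moment P).

End stopped_law.

Section regularity.
Context (k : nat) (V : normedModType R).
Implicit Types c : time T -> C k -> Pp p (C k) -> V.

(* Continuity and Lipschitz continuity for the product distance on
   [0, T] * C^k * P_p(C^k). *)
Definition coef_continuous c : Prop :=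
  forall t x P (eps : R), 0 < eps -> exists2 delta : R, 0 < delta &
    forall s y Q, `|set_val t - set_val s| < delta -> mdist x y < delta ->
      (Wasserstein P Q < delta%:E)%E -> `|c t x P - c s y Q| < eps.

Definition coef_lipschitz (L : R) c : Prop :=
  forall t s x y P Q,
    (`|c t x P - c s y Q|%:E <=
     L%:E * (`|set_val t - set_val s|%:E + (mdist x y)%:E + Wasserstein P Q))%E.

Definition coef_stopped_lipschitz c : Prop :=
  exists2 L : R, 0 < L & exists2 cbar, coef_lipschitz L cbar &
    forall t x P, c t x P = cbar t (stop t x) (stop_law t P).

Definition coef_bounded c : Prop :=
  exists2 M : R, 0 < M & forall t x P, `|c t x P| <= M.

End regularity.

Section equations.
Context (d d' : nat).
Context (b : time T -> C d -> Pp p (C d) -> 'cV[R]_d).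
Context (sigma : time T -> C d -> Pp p (C d) -> 'M[R]_(d, d')).
Context (h : R).

Definition input_space : pmetricType R := ('cV[R]_d * C d')%type.

(* f^{h,P}_t(zeta, w, x), with n = floor (t / h) and t_h = n h. *)
Definition euler (P : Pp p (C d)) (zeta : 'cV[R]_d) (w : C d') (x : C d)
    (t : time T) : 'cV[R]_d :=
  let n := Num.truncn (set_val t / h) in
  let grid (i : nat) := clamp T (i%:R * h) in
  zeta + (set_val t - n%:R * h) *: b (grid n) x P
  + sigma (grid n) x P *m (w t - w (grid n))
  + \sum_(i < n) (h *: b (grid i) x P
                  + sigma (grid i) x P *m (w (grid i.+1) - w (grid i))).

Section on_a_probability_space.
Context {disp : measure_display} {Omega : measurableType disp}.
Context {Pr : probability Omega R}.

Definition McKeanVlasov_solution (Z : Lp Pr p input_space) (X : Lp Pr p (C d)) :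
    Prop :=
  {ae Pr, forall omega, forall t : time T,
     (X omega : C d) t =
     euler (law X) (Z omega : input_space).1 (Z omega : input_space).2
       (X omega) t}.

Definition particle_solution (N : nat) (Z : Lp Pr p 'rV[input_space]_N.+1)
    (X : 'I_N.+1 -> {RV Pr >-> borel (C d)}) : Prop :=
  {ae Pr, forall omega, forall (i : 'I_N.+1) (t : time T),
     (X i omega : C d) t =
     euler (empirical p (fun j => X j omega : C d))
       ((Z omega : 'rV[input_space]_N.+1) 0 i).1
       ((Z omega : 'rV[input_space]_N.+1) 0 i).2 (X i omega) t}.

(* The sigma-algebra generated by the initial data, by the noises stopped at
   time t and by the Pr-null events. *)
Definition input_filtration (N : nat) (Z : Lp Pr p 'rV[input_space]_N.+1)
    (t : time T) : set (set Omega) :=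
  let Zt omega : borel 'rV[input_space]_N.+1 :=
    map_mx (fun z : input_space => (z.1, stop t z.2))
      (Z omega : 'rV[input_space]_N.+1) in
  <<s preimage_set_system setT Zt measurable
      `|` [set A | measurable A /\ Pr A = 0%E] >>.

(* A strong solution is adapted to the augmented filtration of the input. *)
Definition particle_strong (N : nat) (Z : Lp Pr p 'rV[input_space]_N.+1)
    (X : 'I_N.+1 -> {RV Pr >-> borel (C d)}) : Prop :=
  forall (i : 'I_N.+1) (t : time T) (A : set (borel (C d))), measurable A ->
    input_filtration Z t ((fun omega => stop t (X i omega : C d)) @^-1` A).

End on_a_probability_space.

(* Psi maps the law of an input to the law of any solution with this input.  All
   probability spaces are considered, since a given one need not carry an input
   of every law in P_p. *)
Definition solution_law_map (Psi : Pp p input_space -> Pp p (C d)) : Prop :=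
  forall (disp : measure_display) (Omega : measurableType disp)
    (Pr : probability Omega R) (Z : Lp Pr p input_space) (X : Lp Pr p (C d)),
    McKeanVlasov_solution Z X -> measure_eq (law X) (Psi (law Z)).

End equations.

End coefficients.

(* Main.v *)
From HB Require Import structures.
Require Import Defs.
From mathcomp Require Import all_boot all_order all_algebra.
From mathcomp Require Import all_classical all_reals all_analysis.
From mathcomp Require Import measurable_realfun giry ring lra.
Set Implicit Arguments.
Unset Strict Implicit.
Unset Printing Implicit Defensive.
Import Order.TTheory GRing.Theory Num.Theory.
Import numFieldNormedType.Exports.
Local Open Scope classical_set_scope.
Local Open Scope ring_scope.

(** Why the theorem holds.

    At the grid time ih, the coefficients only see the path and the law up to
    ih.  The discretised equation is therefore explicit even though it involves
    the law of its own solution: if mu is the law of the input (zeta, w), the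
    solution stopped at kh is a deterministic function [stage mu k] of the input,
    and the law needed to go from kh to (k+1)h is the image of mu by
    [stage mu k].  A path solves the equation exactly when it is the last stage
    ([euler_stage], [stage_euler]), and the law of the solution is the image
    [solution_law mu] of mu; this is Psi_h.

    The particle system is the same equation.  For a fixed omega, take mu to be
    the empirical measure of the inputs: the image of an empirical measure by a
    map is the empirical measure of the images, so N paths solve the particle
    system exactly when the i-th one is the last stage, for this mu, of the i-th
    input ([particle_unique], [particle_euler]).  Hence (iii), path by path.

    What remains is continuity.  Let gamma be a coupling of mu and nu.  By
    induction on k, the p-cost of [stage mu k] against [stage nu k] under gamma
    is small as soon as the p-cost of gamma is small, mu being fixed
    ([stage_cost]).  The only term of the one-step estimate that is not Lipschitz
    is (sigma - sigma') w, where a Lipschitz factor multiplies an unbounded path;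
    as sigma is bounded, w may be truncated at a level r, and the remainder is
    the tail of the p-th moment of mu beyond r ([step_dist], [tail_integral]).
    This estimate gives the continuity of Psi_h for the Wasserstein distance.
    Applied to the empirical measure of the pairs (z^i, y^i), which couples the
    empirical measures of z and y, it also gives the continuity of the particle
    system in its input, hence the measurability of its solution
    ([particle_continuous]).  Adaptedness is causality: stopping the input at t
    does not change the stages up to t ([stage_causal], [particle_stop]).

    All the maps involved are continuous with linear growth: continuity gives
    their Borel measurability, and that of the maps they induce on pairs, which
    transport couplings; linear growth preserves finite p-th moments. *)

(** * Continuous maps and Borel sets of metric spaces *)

Section metric.
Context {R : realType}.
Implicit Types E F G : pmetricType R.

(** The estimates below produce moduli of continuity, whereas measurability and
    composition need topological continuity. *)
Lemma continuous_mdistP E F (f : E -> F) :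
  continuous f <-> forall x (e : R), 0 < e -> exists2 r : R, 0 < r &
    forall y, mdist x y < r -> mdist (f x) (f y) < e.
Proof.
split=> [cf x e e0|H x A].
  have /cf : nbhs (f x) [set y | mdist (f x) y < e].
    by apply/nbhs_ballP; exists e => //= y; rewrite ballEmdist.
  move=> /nbhs_ballP[r /= r0 sub]; exists r => // y xy.
  by apply: sub; rewrite ballEmdist.
move=> /nbhs_ballP[e /= e0 eA]; have [r r0 xy] := H x e e0.
apply/nbhs_ballP; exists r => //= y; rewrite ballEmdist /= => /xy fxy.
by apply: eA; rewrite ballEmdist.
Qed.

Lemma continuous_mdist_leP E F (f : E -> F) :
  (forall x y, mdist (f x) (f y) <= mdist x y) -> continuous f.
Proof.
move=> H; apply/continuous_mdistP => x e e0; exists e => // y.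
exact: le_lt_trans.
Qed.

Lemma continuous_measurable E F (f : E -> F) : continuous f ->
  @measurable_fun _ _ (borel E) (borel F) setT f.
Proof.
move=> cf.
apply: (@measurability _ _ (borel E) (borel F) setT f (@open F)) => //.
move=> _ [U oU <-]; rewrite setTI; apply: sub_gen_smallest.
by move/continuousP : cf; apply.
Qed.

Lemma preimage_measurable E F (f : E -> F) (A : set (borel F)) :
  continuous f -> measurable A -> measurable (f @^-1` A : set (borel E)).
Proof.
move=> cf mA; rewrite -[X in measurable X]setTI.
exact: (continuous_measurable cf).
Qed.

(** The proof of continuity is an argument so that the measurable structure of
    the map can be inferred from it. *)
Definition borel_map E F (f : E -> F) (cf : continuous f) : borel E -> borel F :=
  f.

HB.instance Definition _ E F (f : E -> F) (cf : continuous f) :=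
  isMeasurableFun.Build _ _ _ _ (borel_map cf) (continuous_measurable cf).

Definition continuous_rv d (Omega : measurableType d) E F (f : E -> F)
    (cf : continuous f) (X : {mfun Omega >-> borel E}) : Omega -> borel F :=
  fun omega => f (X omega).

Lemma continuous_rv_measurable d (Omega : measurableType d) E F (f : E -> F)
    (cf : continuous f) (X : {mfun Omega >-> borel E}) :
  measurable_fun setT (continuous_rv cf X).
Proof.
exact: (measurableT_comp (continuous_measurable cf)
  (@measurable_funPT _ _ _ _ X)).
Qed.

HB.instance Definition _ d (Omega : measurableType d) E F (f : E -> F)
    (cf : continuous f) (X : {mfun Omega >-> borel E}) :=
  isMeasurableFun.Build _ _ _ _ (continuous_rv cf X)
    (continuous_rv_measurable cf X).

Lemma continuous_measurable_real E (f : E -> R) : continuous f ->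
  @measurable_fun _ _ (borel E) R setT f.
Proof.
move=> cf; apply: (measurability _ (RGenInftyO.measurableE R)).
move=> _ [_ [r ->] <-]; rewrite setTI; apply: sub_gen_smallest.
by move/continuousP : cf; apply; exact: interval_open.
Qed.

Lemma mdist_prodE E F (x y : (E * F)%type) :
  mdist x y = Num.max (mdist x.1 y.1) (mdist x.2 y.2).
Proof. by []. Qed.

Lemma ler_mdist_diff E (a b x y : E) :
  `|mdist a b - mdist x y| <= mdist a x + mdist b y.
Proof.
have h1 := metric_triangle a x b; have h2 := metric_triangle x y b.
have h3 := metric_triangle x a y; have h4 := metric_triangle a b y.
rewrite (metric_sym y b) in h2; rewrite (metric_sym x a) in h3.
by rewrite ler_norml; apply/andP; split; lra.
Qed.

Lemma mdist_continuous E : continuous (fun z : E * E => mdist z.1 z.2 : R).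
Proof.
move=> z; apply/cvgrPdist_lt => e e0.
suff : nbhs z [set y | `|mdist z.1 z.2 - mdist y.1 y.2| < e] by [].
apply/nbhs_ballP; exists (e / 2) => /=; first by rewrite divr_gt0.
move=> y; rewrite ballEmdist /= mdist_prodE gt_max => /andP[h1 h2].
apply: le_lt_trans (ler_mdist_diff _ _ _ _) _; lra.
Qed.

Lemma pair_continuous E F G (f : E -> F) (g : E -> G) :
  continuous f -> continuous g -> continuous (fun x => (f x, g x)).
Proof. by move=> cf cg x; apply: cvg_pair; [exact: cf|exact: cg]. Qed.

Lemma compose_continuous (E F G : topologicalType) (f : E -> F) (g : F -> G) :
  continuous f -> continuous g -> continuous (g \o f).
Proof. by move=> cf cg x; apply: continuous_comp; [exact: cf|exact: cg]. Qed.

Lemma fst_continuous E F (f : E -> F) : continuous f ->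
  continuous (fun z : E * E => f z.1).
Proof.
by move=> cf; apply: (compose_continuous (f := fst) _ cf) => z; exact: cvg_fst.
Qed.

Lemma snd_continuous E F (f : E -> F) : continuous f ->
  continuous (fun z : E * E => f z.2).
Proof.
by move=> cf; apply: (compose_continuous (f := snd) _ cf) => z; exact: cvg_snd.
Qed.

Lemma id_continuous E : continuous (@id E).
Proof. by move=> x A. Qed.

End metric.

(** * Inequalities for p-th powers *)

Section powR.
Context {R : realType} (p : R) (p1 : 1 <= p).

Let p_ge0 : 0 <= p. Proof. exact: le_trans p1. Qed.
Let p_gt0 : 0 < p. Proof. exact: lt_le_trans p1. Qed.

(** The sum is at most twice the larger term, which gives a constant cruder
    than the one obtained by convexity, but enough here. *)
Lemma powRD_le (a b : R) : 0 <= a -> 0 <= b ->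
  (a + b) `^ p <= 2 `^ p * (a `^ p + b `^ p).
Proof.
move=> a0 b0; wlog ab : a b a0 b0 / b <= a => [H|].
  have [|/ltW] := leP b a; first exact: H.
  by rewrite addrC (addrC (a `^ p)); exact: H.
apply: (@le_trans _ _ (2 `^ p * a `^ p)).
  rewrite -powRM//; apply: ge0_ler_powR => //; rewrite ?nnegrE; lra.
by rewrite ler_wpM2l ?powR_ge0// lerDl powR_ge0.
Qed.

Lemma powR3_le (a b1 b2 : R) : 0 <= a -> 0 <= b1 -> 0 <= b2 ->
  (a + b1 + b2) `^ p <= 2 `^ p * 2 `^ p * (a `^ p + b1 `^ p + b2 `^ p).
Proof.
move=> a0 b10 b20; have two : 1 <= 2 `^ p :> R.
  by rewrite -[leLHS](powRr0 2); apply: ler_powR => //; rewrite ler1n.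
apply: le_trans (powRD_le _ b20) _; first exact: addr_ge0.
rewrite -mulrA ler_wpM2l ?powR_ge0// mulrDr; apply: lerD.
  exact: powRD_le.
by rewrite ler_peMl ?powR_ge0.
Qed.

Lemma powR_root (a : R) : 0 <= a -> (a `^ p) `^ p^-1 = a.
Proof. by move=> a0; rewrite -powRrM mulfV ?gt_eqF// powRr1. Qed.

Lemma root_powR (a : R) : 0 <= a -> (a `^ p^-1) `^ p = a.
Proof. by move=> a0; rewrite -powRrM mulVf ?gt_eqF// powRr1. Qed.

Lemma poweR_root_lt (a : \bar R) (e : R) : (0 <= a)%E -> 0 < e ->
  (a < (e `^ p)%:E)%E -> (a `^ p^-1 < e%:E)%E.
Proof.
move=> a0 e0; case: a a0 => [a||]//; rewrite lee_fin => a0.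
rewrite lte_fin => ae; rewrite poweR_EFin lte_fin -[ltRHS]powR_root ?ltW//.
by apply: gt0_ltr_powR; rewrite ?invr_gt0 ?nnegrE ?powR_ge0.
Qed.

Lemma poweR_root_gt (a : \bar R) (e : R) : (0 <= a)%E -> 0 < e ->
  (a `^ p^-1 < e%:E)%E -> (a < (e `^ p)%:E)%E.
Proof.
move=> a0 e0; case: a a0 => [a||]//; rewrite ?lee_fin => a0; last first.
  by rewrite poweRyr ?invr_eq0 ?gt_eqF.
rewrite poweR_EFin !lte_fin => ae; rewrite -[ltLHS]root_powR//.
by apply: gt0_ltr_powR; rewrite ?nnegrE ?powR_ge0 ?ltW.
Qed.

End powR.

(** * Images of measures with finite p-th moment *)

Section measures.
Context {R : realType} (p : R) (p1 : 1 <= p).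
Implicit Types E F G : pmetricType R.

Let p_ge0 : 0 <= p. Proof. exact: le_trans p1. Qed.

Lemma measurable_continuous_powR E (f : E -> R) : continuous f ->
  @measurable_fun _ _ (borel E) (\bar R) setT (fun x => (f x `^ p)%:E).
Proof.
move=> cf; apply/measurable_EFinP; apply: (measurableT_comp (measurable_powR p)).
exact: continuous_measurable_real.
Qed.

Lemma measurable_cost E F (f g : E -> F) : continuous f -> continuous g ->
  @measurable_fun _ _ (borel E) (\bar R) setT
    (fun x => (mdist (f x) (g x) `^ p)%:E).
Proof.
move=> cf cg; apply: (measurable_continuous_powR (f := fun x => mdist (f x) (g x))).
exact: (compose_continuous (pair_continuous cf cg) (@mdist_continuous _ F)).
Qed.

Definition linear_growth E F (f : E -> F) : Prop :=
  forall x0 : E, exists2 c : R, 0 <= c &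
    forall x, mdist (f x0) (f x) <= c * (1 + mdist x0 x).

(** Continuity makes images of Borel measures available, and linear growth makes
    these images keep a finite p-th moment. *)
Record tame_map E F := TameMap {
  tame_fun :> E -> F;
  tame_continuous : continuous tame_fun;
  tame_growth : linear_growth tame_fun }.

Arguments tame_continuous {E F} t _.
Arguments tame_growth {E F} t _.

Lemma measurable_mdist_rv E d (Omega : measurableType d)
    (X : {mfun Omega >-> borel E}) (x0 : E) :
  measurable_fun setT (fun w => (mdist x0 (X w) `^ p)%:E).
Proof.
exact: (measurableT_comp (@measurable_mdist_powR R p E x0)
  (@measurable_funPT _ _ _ _ X)).
Qed.

Lemma integral_mdist_distribution E d (Omega : measurableType d)
    (Pr : probability Omega R) (X : {mfun Omega >-> borel E}) (x0 : E) :
  (\int[distribution Pr X]_x (mdist x0 x `^ p)%:E =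
   \int[Pr]_w (mdist x0 (X w) `^ p)%:E)%E.
Proof.
have f0 (y : borel E) : (0 <= (mdist x0 y `^ p)%:E)%E.
  by rewrite lee_fin powR_ge0.
exact: (@ge0_integral_distribution _ _ _ _ R Pr X _
  (@measurable_mdist_powR R p E x0) f0).
Qed.

Lemma tame_moment E F (f : tame_map E F) d (Omega : measurableType d)
    (Pr : probability Omega R) (X : {mfun Omega >-> borel E})
    (Y : {mfun Omega >-> borel F}) :
  (forall omega, Y omega = f (X omega)) ->
  finite_moment p (distribution Pr X) -> finite_moment p (distribution Pr Y).
Proof.
move=> YfX [x0]; rewrite integral_mdist_distribution => Px0; exists (f x0).
rewrite integral_mdist_distribution.
have [c c0 fc] := tame_growth f x0.
have mY := measurable_mdist_rv Y (f x0).
have mX := measurable_mdist_rv X x0.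
pose k := c `^ p * 2 `^ p.
have k0 : 0 <= k by rewrite mulr_ge0 ?powR_ge0.
apply: (@le_lt_trans _ _
    (\int[Pr]_w (k%:E * (1 + (mdist x0 (X w) `^ p)%:E))%E)%E).
  apply: ge0_le_integral => //.
  - by move=> w _; rewrite lee_fin powR_ge0.
  - by apply: emeasurable_funM => //; exact: emeasurable_funD.
  - move=> w _; rewrite /= YfX -EFinD -EFinM lee_fin /k -mulrA.
    apply: (@le_trans _ _ ((c * (1 + mdist x0 (X w))) `^ p)).
      apply: ge0_ler_powR; rewrite ?nnegrE ?mdist_ge0//.
      by rewrite mulr_ge0// addr_ge0// mdist_ge0.
    rewrite powRM ?addr_ge0 ?mdist_ge0// ler_wpM2l ?powR_ge0//.
    apply: le_trans (powRD_le p1 _ _) _ => //; first exact: mdist_ge0.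
    by rewrite powR1.
rewrite ge0_integralZl_EFin//; last 2 first.
- by move=> w _; rewrite adde_ge0// lee_fin powR_ge0.
- exact: emeasurable_funD.
rewrite ge0_integralD//; last first.
- by move=> w _; rewrite lee_fin powR_ge0.
rewrite integral_cst// mul1e [X in (X + _)%E]probability_setT.
apply: lte_mul_pinfty; rewrite ?lee_fin//.
by rewrite lte_add_pinfty// ltry.
Qed.

Lemma push_moment E F (f : tame_map E F) (P : Pp p E) :
  finite_moment p (distribution P (borel_map (tame_continuous f))).
Proof.
pose X : {mfun borel E >-> borel E} := borel_map (@id_continuous R E).
apply: (@tame_moment _ _ f _ _ P X (borel_map (tame_continuous f))) => //.
case: (Pp_moment P) => x0 H; exists x0.
by rewrite integral_mdist_distribution.
Qed.

Definition push E F (f : tame_map E F) (P : Pp p E) : Pp p F :=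
  MkPp (push_moment f P).

End measures.

Arguments tame_continuous {R E F} t _.
Arguments tame_growth {R E F} t _.
Arguments continuous_rv {R d Omega E F f} cf X _.

(** * Couplings, tails and empirical measures *)

Section couplings.
Context {R : realType} (p : R) (p1 : 1 <= p).
Implicit Types E F G : pmetricType R.

Let p_ge0 : 0 <= p. Proof. exact: le_trans p1. Qed.
Let p_gt0 : 0 < p. Proof. exact: lt_le_trans p1. Qed.

Lemma measurable_dist_powR E :
  @measurable_fun _ _ (borel (E * E)%type) (\bar R) setT
    (fun z => (mdist z.1 z.2 `^ p)%:E).
Proof.
exact: (measurable_continuous_powR p (@mdist_continuous _ E)).
Qed.

Lemma cost_ge0 E d (Omega : measurableType d) (mu : measure Omega R)
    (f g : Omega -> E) :
  (0 <= \int[mu]_w (mdist (f w) (g w) `^ p)%:E)%E.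
Proof. by apply: integral_ge0 => w _; rewrite lee_fin powR_ge0. Qed.

Lemma cost_le E F (g : probability (borel E) R)
    (u v : E -> F) (w : E -> \bar R) : continuous u -> continuous v ->
  @measurable_fun _ _ (borel E) (\bar R) setT w ->
  (forall z, ((mdist (u z) (v z) `^ p)%:E <= w z)%E) ->
  (\int[g]_z (mdist (u z) (v z) `^ p)%:E <= \int[g]_z w z)%E.
Proof.
move=> cu cv mw uvw; apply: ge0_le_integral => //.
  by move=> z _; rewrite lee_fin powR_ge0.
exact: measurable_cost.
Qed.

Lemma integral_affine_le E (g : probability (borel E) R)
    (f1 f2 f3 : E -> \bar R) (a b' c x1 x2 x3 : R) :
  0 <= a -> 0 <= b' -> 0 <= c ->
  @measurable_fun _ _ (borel E) (\bar R) setT f1 ->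
  @measurable_fun _ _ (borel E) (\bar R) setT f2 ->
  @measurable_fun _ _ (borel E) (\bar R) setT f3 ->
  (forall z, 0 <= f1 z)%E -> (forall z, 0 <= f2 z)%E -> (forall z, 0 <= f3 z)%E ->
  (\int[g]_z f1 z <= x1%:E)%E -> (\int[g]_z f2 z <= x2%:E)%E ->
  (\int[g]_z f3 z <= x3%:E)%E ->
  (\int[g]_z (a%:E * (f1 z + c%:E) + b'%:E * f2 z + b'%:E * f3 z) <=
   (a * (x1 + c) + b' * x2 + b' * x3)%:E)%E.
Proof.
move=> a0 b0 c0 m1 m2 m3 f10 f20 f30 i1 i2 i3.
have mc : @measurable_fun _ _ (borel E) (\bar R) setT (fun z => f1 z + c%:E)%E.
  exact: emeasurable_funD.
have mZ k (f : borel E -> \bar R) : measurable_fun setT f ->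
    measurable_fun setT (fun z => k%:E * f z)%E.
  by move=> mf; apply: emeasurable_funM.
have gZ k (f : borel E -> \bar R) : 0 <= k -> (forall z, 0 <= f z)%E ->
    forall z : borel E, [set: borel E] z -> (0 <= k%:E * f z)%E.
  by move=> k0 f0 z _; rewrite mule_ge0.
have c1 (z : borel E) : (0 <= f1 z + c%:E)%E by rewrite adde_ge0.
have s1 (z : borel E) : [set: borel E] z ->
    (0 <= a%:E * (f1 z + c%:E) + b'%:E * f2 z)%E.
  by move=> _; rewrite adde_ge0 ?mule_ge0.
have ms : @measurable_fun _ _ (borel E) (\bar R) setT
    (fun z => a%:E * (f1 z + c%:E) + b'%:E * f2 z)%E.
  by apply: emeasurable_funD; exact: mZ.
rewrite (ge0_integralD g measurableT s1 ms (gZ _ _ b0 f30) (mZ _ _ m3)).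
rewrite (ge0_integralD g measurableT (gZ _ _ a0 c1) (mZ _ _ mc) (gZ _ _ b0 f20)
  (mZ _ _ m2)).
rewrite !ge0_integralZl_EFin// ge0_integralD//.
have gT : (\int[g]_z c%:E = c%:E)%E.
  by rewrite integral_cst// [X in (_ * X)%E]probability_setT mule1.
rewrite gT !EFinD !EFinM EFinD.
by rewrite !leeD// lee_wpmul2l// leeD.
Qed.

(** A pair of random variables on any probability space is a coupling of their
    laws. *)
Lemma Wasserstein_le_cost E d (Omega : measurableType d)
    (Pr : probability Omega R) (V : {mfun Omega >-> borel (E * E)%type})
    (P Q : Pp p E) :
  (forall A : set (borel E), measurable A ->
     Pr (V @^-1` (fst @^-1` A)) = P A /\ Pr (V @^-1` (snd @^-1` A)) = Q A) ->
  (Wasserstein P Q <=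
   (\int[Pr]_w (mdist (V w).1 (V w).2 `^ p)%:E) `^ p^-1)%E.
Proof.
move=> HV; rewrite /Wasserstein.
have g0 (z : borel (E * E)%type) : (0 <= (mdist z.1 z.2 `^ p)%:E)%E.
  by rewrite lee_fin powR_ge0.
have <- := @ge0_integral_distribution _ _ _ _ R Pr V _ (@measurable_dist_powR E) g0.
apply: gt0_ler_poweR; rewrite ?invr_ge0 ?in_itv /= ?leey ?andbT//.
- apply: le_ereal_inf_tmp => _ [g _ <-]; exact: cost_ge0.
- exact: cost_ge0.
by apply: ereal_inf_lbound; exists (distribution Pr V).
Qed.

Lemma Wasserstein_lt_cost E (P Q : Pp p E) (e : R) : 0 < e ->
  (Wasserstein P Q < e%:E)%E ->
  exists2 g : probability (borel (E * E)%type) R, couplings P Q g &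
    (\int[g]_z (mdist z.1 z.2 `^ p)%:E < (e `^ p)%:E)%E.
Proof.
move=> e0 /(poweR_root_gt p1) H.
have : (ereal_inf [set \int[g]_z (mdist z.1 z.2 `^ p)%:E | g in couplings P Q]
   < (e `^ p)%:E)%E.
  by apply: H => //; apply: le_ereal_inf_tmp => _ [g _ <-]; exact: cost_ge0.
by move=> /ereal_inf_lt[_ /= [g Pg <-] lt]; exists g.
Qed.

Lemma Wasserstein_push_lt E F (P Q : Pp p E)
    (g : probability (borel (E * E)%type) R) (u v : E -> F) (P' Q' : Pp p F)
    (e : R) : 0 < e -> couplings P Q g -> continuous u -> continuous v ->
  (forall A : set (borel F), measurable A -> P' A = P (u @^-1` A)) ->
  (forall A : set (borel F), measurable A -> Q' A = Q (v @^-1` A)) ->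
  (\int[g]_z (mdist (u z.1) (v z.2) `^ p)%:E < (e `^ p)%:E)%E ->
  (Wasserstein P' Q' < e%:E)%E.
Proof.
move=> e0 gPQ cu cv P'E Q'E lt.
have cV : continuous (fun z : E * E => (u z.1, v z.2)).
  exact: pair_continuous (fst_continuous cu) (snd_continuous cv).
pose V : {mfun borel (E * E)%type >-> borel (F * F)%type} := borel_map cV.
apply: (@le_lt_trans _ _
    ((\int[g]_z (mdist (u z.1) (v z.2) `^ p)%:E) `^ p^-1)%E).
  apply: (@Wasserstein_le_cost _ _ _ g V) => A mA; split.
    by rewrite P'E//; apply: (gPQ (u @^-1` A) _).1; exact: preimage_measurable.
  by rewrite Q'E//; apply: (gPQ (v @^-1` A) _).2; exact: preimage_measurable.
by apply: poweR_root_lt => //; exact: cost_ge0.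
Qed.

(** The diagonal coupling.  Elements of [Pp p E] that agree on Borel sets need not
    be equal, and this is how the coefficients, being Lipschitz, are seen not to
    distinguish them. *)
Lemma Wasserstein_eq0 E (P Q : Pp p E) :
  measure_eq P Q -> Wasserstein P Q = 0%E.
Proof.
move=> PQ; apply/eqP; rewrite eq_le poweR_ge0 andbT.
have cV : continuous (fun x : E => (x, x)).
  by apply: pair_continuous => x A.
pose V : {mfun borel E >-> borel (E * E)%type} := borel_map cV.
apply: (le_trans (@Wasserstein_le_cost _ _ _ P V _ _ _)).
  by move=> A mA; split => //; exact: PQ.
rewrite integral0_eq ?poweR0r ?invr_eq0 ?gt_eqF// => x _ /=.
by rewrite mdistxx powR0 ?gt_eqF.
Qed.

Lemma coupling_integral_fst E (P Q : probability (borel E) R) g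
    (f : borel E -> \bar R) : couplings P Q g -> measurable_fun setT f ->
  (forall x, 0 <= f x)%E -> (\int[g]_z f z.1 = \int[P]_x f x)%E.
Proof.
move=> gPQ mf f0.
have cfst : continuous (@fst E E) := fst_continuous (@id_continuous _ E).
have mfst := continuous_measurable cfst.
have := @ge0_integral_pushforward _ _ (borel (E * E)%type) (borel E) R _ mfst g
  setT f measurableT mf (fun y _ => f0 y).
rewrite preimage_setT => <-.
by apply: eq_measure_integral => A mA _; exact: (gPQ A mA).1.
Qed.

Lemma mdist_from_continuous E (x0 : E) : continuous (fun x : E => mdist x0 x : R).
Proof.
apply: (compose_continuous (f := fun x => (x0, x)) _ (@mdist_continuous _ E)).
by apply: pair_continuous => x; [exact: cvg_cst|exact: cvg_id].
Qed.

Lemma measurable_tail E (x0 : E) (r : R) :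
  @measurable_fun _ _ (borel E) (\bar R) setT
    (fun x => (Num.max 0 (mdist x0 x - r) `^ p)%:E).
Proof.
apply: (measurable_continuous_powR p (f := fun x => Num.max 0 (mdist x0 x - r))).
move=> x; apply: (@continuous_max _ _ (cst 0) (fun x => mdist x0 x - r)).
  exact: cvg_cst.
by apply: cvgB; [exact: mdist_from_continuous|exact: cvg_cst].
Qed.

(** Dominated convergence as r tends to infinity, the truncated functions being
    bounded by the p-th power of the distance itself. *)
Lemma tail_integral E (P : Pp p E) (e : R) : 0 < e ->
  exists x0 : E, exists2 r : R, 0 <= r &
    (\int[P]_x (Num.max 0 (mdist x0 x - r) `^ p)%:E < e%:E)%E.
Proof.
move=> e0; have [x0 Px0] := Pp_moment P; exists x0.
pose f (n : nat) (x : borel E) := (Num.max 0 (mdist x0 x - n%:R) `^ p)%:E.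
have mf n : measurable_fun setT (f n) by exact: measurable_tail.
have [] := @dominated_convergence _ (borel E) R P setT measurableT f (cst 0%E)
  (fun x => (mdist x0 x `^ p)%:E) mf (measurable_cst _).
- apply: aeW => x _; apply: cvg_near_cst.
  exists (Num.truncn (mdist x0 x)).+1 => // n /= xn; rewrite /f.
  rewrite (max_idPl _) ?powR0 ?gt_eqF// subr_le0.
  apply: le_trans (ltW (truncnS_gt _)) _; by rewrite ler_nat.
- apply/integrableP; split; first exact: measurable_mdist_powR.
  by under eq_integral do rewrite gee0_abs ?lee_fin ?powR_ge0//.
- apply: aeW => x n _; rewrite gee0_abs ?lee_fin ?powR_ge0//.
  apply: ge0_ler_powR; rewrite ?nnegrE ?mdist_ge0// ?le_max ?lexx//.
  by rewrite ge_max mdist_ge0 /= gerBl.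
move=> _ _; rewrite integral0 => /fine_cvgP[nfin /cvgrPdist_lt/(_ e e0) H].
have [n /= [fn]] := filter_ex (filterI nfin H).
rewrite sub0r normrN => ltn; exists n%:R => //.
rewrite -[X in (X < _)%E](fineK fn) lte_fin.
exact: le_lt_trans (ler_norm _) ltn.
Qed.

Lemma empirical_integral E N (x : 'I_N.+1 -> E) (f : borel E -> \bar R) :
  measurable_fun setT f -> (forall y, 0 <= f y)%E ->
  (\int[empirical p x]_y f y =
   (N.+1%:R^-1)%:E * \sum_(i < N.+1) f (x i))%E.
Proof.
move=> mf f0; rewrite /empirical /= /empirical_fun /empirical_measure.
rewrite ge0_integral_mscale//.
rewrite ge0_integral_measure_sum//; congr (_ * _)%E.
by apply: eq_bigr => i _; rewrite /= integral_dirac// diracT mul1e inord_val.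
Qed.

(** This is why the particle system is the equation with an empirical input law. *)
Lemma empirical_comp E F N (x : 'I_N.+1 -> E) (y : 'I_N.+1 -> F) (f : E -> F)
    (A : set (borel F)) : (forall i, y i = f (x i)) ->
  empirical p y A = empirical p x (f @^-1` A).
Proof.
move=> yE; rewrite !empiricalE; congr (_ * _)%E; apply: eq_bigr => i _.
by rewrite !diracE yE; congr (_%:R%:E)%E; congr nat_of_bool; apply/idP/idP;
  rewrite !inE.
Qed.

Lemma empirical_coupling E N (x y : 'I_N.+1 -> E) :
  couplings (empirical p x) (empirical p y)
    (empirical p (fun i => (x i, y i))).
Proof.
by move=> A _; split; apply/esym; exact: empirical_comp.
Qed.

End couplings.

(** * Increments of paths *)

Lemma subr_interchange (V : zmodType) (a b a' b' : V) :
  a - b - (a' - b') = a - a' - (b - b').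
Proof. by rewrite !opprB addrACA [RHS]addrACA [- b - a']addrC. Qed.

Section matrix_norm.
Context {R : realType}.

Lemma ler_norm_mulmx m n q (A : 'M[R]_(m, n)) (B : 'M[R]_(n, q)) :
  `|A *m B| <= n%:R * `|A| * `|B|.
Proof.
have entry (k l : nat) (M : 'M[R]_(k, l)) i j : `|M i j| <= `|M|.
  rewrite [leRHS]/Num.norm /= mx_normrE.
  exact: (le_bigmax _ (fun ij : 'I_k * 'I_l => `|M ij.1 ij.2|) (i, j)).
rewrite [leLHS]/Num.norm /= mx_normrE; apply: bigmax_le => [|[i j] _ /=].
  by rewrite !mulr_ge0.
rewrite mxE; apply: le_trans (ler_norm_sum _ _ _) _.
rewrite -mulrA mulr_natl -[X in _ *+ X](card_ord n) -sumr_const.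
by apply: ler_sum => l _; rewrite normrM ler_pM ?entry.
Qed.

(** The difference of two steps of the scheme, arranged so that the variation
    of S multiplies the unprimed increment D only. *)
Lemma increment_sub d d' (x x' B B' : 'cV[R]_d) (S S' : 'M[R]_(d, d'))
    (D D' : 'cV[R]_d') (m : R) :
  x + (m *: B + S *m D) - (x' + (m *: B' + S' *m D')) =
  (x - x') + m *: (B - B') + (S - S') *m D + S' *m (D - D').
Proof.
rewrite mulmxBl mulmxBr.
move: (S *m D) (S' *m D) (S' *m D') => SD S'D S'D'.
by apply/matrixP => i j; rewrite !mxE; ring.
Qed.

Lemma continuous_increment (X : topologicalType) d d' (x : X -> 'cV[R]_d)
    (m1 m2 : X -> R) (w1 w2 : X -> 'cV[R]_d') B (S : 'M[R]_(d, d')) :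
  continuous x -> continuous m1 -> continuous m2 -> continuous w1 ->
  continuous w2 ->
  continuous (fun s => x s + ((m1 s - m2 s) *: B + S *m (w1 s - w2 s))).
Proof.
move=> cx cm1 cm2 cw1 cw2 s; apply: cvgD; first exact: cx.
apply: cvgD; first by apply: cvgZr_tmp; apply: cvgB; [exact: cm1|exact: cm2].
have /cvgrPdist_lt cw : w1 r - w2 r @[r --> s] --> w1 s - w2 s.
  by apply: cvgB; [exact: cw1|exact: cw2].
apply/cvgrPdist_lt => e e0.
have k0 : 0 < d'%:R * `|S| + 1 by rewrite ltr_wpDl// mulr_ge0.
have ek0 : 0 < e / (d'%:R * `|S| + 1) by rewrite divr_gt0.
near=> r.
have : `|w1 s - w2 s - (w1 r - w2 r)| < e / (d'%:R * `|S| + 1).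
  by near: r; exact: cw.
rewrite -mulmxBr ltr_pdivlMr// mulrC; apply: le_lt_trans.
apply: le_trans (ler_norm_mulmx _ _) _.
by rewrite ler_wpM2r// lerDl.
Unshelve. all: by end_near. Qed.

End matrix_norm.

Section paths.
Context {R : realType} (T : {posnum R}).
Implicit Types (u v s t : time T).

Lemma set_val_clamp (r : R) : 0 <= r <= T%:num -> set_val (clamp T r) = r.
Proof.
move=> /andP[r0 rT]; have -> : set_val (clamp T r) = Num.max 0 (Num.min r T%:num) by [].
by rewrite (min_idPl rT) (max_idPr r0).
Qed.

Definition tmin s t : time T := clamp T (Num.min (set_val s) (set_val t)).

Lemma tmin_val s t : set_val (tmin s t) = Num.min (set_val s) (set_val t).
Proof.
have /andP[s0 sT] := time_itv s; have /andP[t0 tT] := time_itv t.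
by rewrite set_val_clamp// le_min s0 t0 ge_min sT.
Qed.

Lemma tmin_l s t : set_val s <= set_val t -> tmin s t = s.
Proof. by move=> st; rewrite /tmin (min_idPl st) clampK. Qed.

Lemma tmin_r s t : set_val t <= set_val s -> tmin s t = t.
Proof. by move=> ts; rewrite /tmin (min_idPr ts) clampK. Qed.

Lemma tminA : associative tmin.
Proof.
move=> r s t; rewrite -[LHS]clampK -[RHS]clampK.
by rewrite (tmin_val r (tmin s t)) (tmin_val s t) (tmin_val (tmin r s) t)
  (tmin_val r s) minA.
Qed.

Lemma tminC : commutative tmin.
Proof. by move=> s t; rewrite /tmin minC. Qed.

Lemma tmin_continuous t : continuous (tmin^~ t).
Proof.
move=> s; apply: (@continuous_comp _ _ _ (set_val : time T -> R)
  (fun a => clamp T (Num.min a (set_val t)))).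
  exact: initial_continuous.
by apply: continuous_comp; [exact: minl_continuous|exact: clamp_continuous].
Qed.

Lemma stop_continuous k t : continuous (@stop R T k t).
Proof. by apply: continuous_mdist_leP => x y; exact: mdist_stop. Qed.

Lemma stopE k (x : Cpath T k) t s :
  stop t x s = x (tmin s t).
Proof. by []. Qed.

Lemma stop_stop k (x : Cpath T k) s t : stop s (stop t x) = stop (tmin s t) x.
Proof.
apply/continuousEP => r; rewrite [LHS](_ : _ = x (tmin (tmin r s) t))//.
by rewrite -tminA.
Qed.

Lemma stop_id k (x : Cpath T k) t : set_val t = T%:num -> stop t x = x.
Proof.
move=> tT; apply/continuousEP => s; rewrite stopE tmin_l// tT.
by have /andP[] := time_itv s.
Qed.

Section extension.
Context (d d' : nat).
Implicit Types (x : Cpath T d) (B : 'cV[R]_d) (S : 'M[R]_(d, d')).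
Implicit Types (w : Cpath T d').

(** One step of the scheme from time u to time v.  Writing the increments with
    minima makes one formula valid for all times s: the added term vanishes up to
    u and is constant after v. *)
Definition extend_fun u v x B S w s : 'cV[R]_d :=
  x s + ((set_val (tmin s v) - set_val (tmin s u)) *: B
         + S *m (w (tmin s v) - w (tmin s u))).

Lemma extend_fun_continuous u v x B S w : continuous (extend_fun u v x B S w).
Proof.
have cmin u0 : continuous (fun s : time T => set_val (tmin s u0) : R).
  apply: compose_continuous (@tmin_continuous u0) _.
  exact: initial_continuous.
have cw u0 : continuous (fun s : time T => w (tmin s u0)).
  exact: compose_continuous (@tmin_continuous u0) (@cts_fun _ _ w).
by apply: continuous_increment; [exact: cts_fun|exact: cmin|exact: cmin| |].
Qed.

HB.instance Definition _ u v x B S w :=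
  isContinuous.Build _ _ (extend_fun u v x B S w)
    (@extend_fun_continuous u v x B S w).

Definition extend u v x B S w : Cpath T d := extend_fun u v x B S w.

Lemma extendE u v x B S w s : extend u v x B S w s =
  x s + ((set_val (tmin s v) - set_val (tmin s u)) *: B
         + S *m (w (tmin s v) - w (tmin s u))).
Proof. by []. Qed.

(** The bound c is asked of w and not of w', because in the stability estimate
    only the law of the first input is fixed. *)
Lemma mdist_extend u v x x' B B' S S' w w' (c : R) :
  (forall s, `|w s| <= c) ->
  mdist (extend u v x B S w) (extend u v x' B' S' w') <=
    mdist x x' + T%:num * `|B - B'| + 2 * d'%:R * `|S - S'| * c
    + 2 * d'%:R * `|S'| * mdist w w'.
Proof.
move=> wc; apply: path_mdist_ge => s; rewrite !extendE.
set m := _ - set_val _; set D := w (tmin s v) - _; set D' := w' (tmin s v) - _.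
have -> : x s + (m *: B + S *m D) - (x' s + (m *: B' + S' *m D')) =
    (x s - x' s) + m *: (B - B') + (S - S') *m D + S' *m (D - D').
  exact: increment_sub.
have mT : `|m| <= T%:num.
  have /andP[u0 uT] := time_itv (tmin s u).
  have /andP[v0 vT] := time_itv (tmin s v).
  by rewrite ler_norml /m; apply/andP; split; lra.
have D2 : `|D| <= 2 * c.
  apply: le_trans (ler_normB _ _) _; rewrite mulr_natl mulr2n.
  by apply: lerD; exact: wc.
have DD' : `|D - D'| <= 2 * mdist w w'.
  rewrite /D /D' subr_interchange.
  apply: le_trans (ler_normB _ _) _; rewrite mulr_natl mulr2n.
  by apply: lerD; exact: path_mdist_le.
apply: le_trans (ler_normD _ _) _; apply: lerD; last first.
  apply: le_trans (ler_norm_mulmx _ _) _.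
  rewrite [leRHS](_ : _ = d'%:R * `|S'| * (2 * mdist w w')); last by lra.
  by rewrite ler_wpM2l// mulr_ge0.
apply: le_trans (ler_normD _ _) _; apply: lerD; last first.
  apply: le_trans (ler_norm_mulmx _ _) _.
  rewrite [leRHS](_ : _ = d'%:R * `|S - S'| * (2 * c)); last by lra.
  by rewrite ler_wpM2l// mulr_ge0.
apply: le_trans (ler_normD _ _) _; apply: lerD; first exact: path_mdist_le.
by rewrite normrZ ler_wpM2r.
Qed.

End extension.
End paths.

(** * Euler polygons *)

Section polygon.
Context {R : realType} (T : {posnum R}) (d d' : nat) (h : R).
Implicit Types (u v s t : time T) (x : Cpath T d) (w : Cpath T d').

Lemma extend_degenerate u x (B : 'cV[R]_d) (S : 'M[R]_(d, d')) w :
  extend u u x B S w = x.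
Proof.
apply/continuousEP => s.
by rewrite extendE !subrr scale0r mulmx0 !addr0.
Qed.

(** Stopping at t turns the step from u to v into the step from min(u, t) to
    min(v, t); it is degenerate if t is before u, and unchanged if t is after v. *)
Lemma stop_extend t u v x (B : 'cV[R]_d) (S : 'M[R]_(d, d')) w :
  stop t (extend u v x B S w) =
  extend (tmin u t) (tmin v t) (stop t x) B S (stop t w).
Proof.
apply/continuousEP => s; rewrite stopE !extendE !stopE.
have E r : tmin s (tmin r t) = tmin (tmin s t) r by rewrite (tminC r) tminA.
have E' r : tmin (tmin (tmin s t) r) t = tmin (tmin s t) r.
  by rewrite -tminA (tminC r) tminA -(tminA s) (@tmin_l _ _ t t).
by rewrite !E !E'.
Qed.

Definition grid (i : nat) : time T := clamp T (i%:R * h).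

(** The coefficients B and S are given sequences here: solutions of the scheme
    are the polygons whose coefficients are computed along themselves. *)
Fixpoint polygon (zeta : 'cV[R]_d) w (B : nat -> 'cV[R]_d)
    (S : nat -> 'M[R]_(d, d')) (k : nat) : Cpath T d :=
  if k is k.+1 then
    extend (grid k) (grid k.+1) (polygon zeta w B S k) (B k) (S k) w
  else (cst zeta : continuousType (time T) 'cV[R]_d).

Lemma eq_polygon zeta w B B' S S' k :
  (forall i, (i < k)%N -> B i = B' i) -> (forall i, (i < k)%N -> S i = S' i) ->
  polygon zeta w B S k = polygon zeta w B' S' k.
Proof.
elim: k => // k IH BB SS /=; rewrite BB// SS// IH// => i ik.
  exact/BB/ltnW.
exact/SS/ltnW.
Qed.

Hypothesis h_gt0 : 0 < h.

Lemma grid_val i : set_val (grid i) = Num.min (i%:R * h) T%:num.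
Proof.
have -> : set_val (grid i) = Num.max 0 (Num.min (i%:R * h) T%:num) by [].
by apply/max_idPr; rewrite le_min ge0 andbT mulr_ge0// ltW.
Qed.

Lemma grid_le i j : (i <= j)%N -> set_val (grid i) <= set_val (grid j).
Proof.
move=> ij; rewrite !grid_val le_min ge_min ler_pM2r// ler_nat ij /=.
by rewrite ge_min lexx orbT.
Qed.

(** Enough steps to pass T; the last grid times are cut at T by [clamp]. *)
Definition steps : nat := (Num.truncn (T%:num / h)).+1.

Lemma grid_steps : set_val (grid steps) = T%:num.
Proof.
rewrite grid_val; apply/min_idPr; rewrite -ler_pdivrMr// ltW//.
exact: truncnS_gt.
Qed.

Lemma stop_polygon zeta w B S k j : (k <= j)%N ->
  stop (grid k) (polygon zeta w B S j) = polygon zeta w B S k.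
Proof.
elim: j k => [|j IH] k.
  by rewrite leqn0 => /eqP ->; apply/continuousEP.
rewrite leq_eqVlt => /predU1P[->|]; last first.
  rewrite ltnS => kj /=; have kj1 := leqW kj.
  rewrite stop_extend (tmin_r (grid_le kj)) (tmin_r (grid_le kj1)).
  by rewrite extend_degenerate IH.
have gj : set_val (grid j) <= set_val (grid j.+1) by exact: grid_le.
rewrite /= stop_extend tmin_l// tmin_l// -{1}(IH j (leqnn j)) stop_stop tmin_r//.
rewrite (IH j (leqnn j)); apply/continuousEP => s; rewrite !extendE !stopE.
by rewrite -!tminA (tmin_l (lexx _)) (@tmin_l _ _ (grid j)).
Qed.

Lemma polygonE zeta w B S k t :
  polygon zeta w B S k t = zeta + \sum_(i < k)
    ((set_val (tmin t (grid i.+1)) - set_val (tmin t (grid i))) *: B i +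
      S i *m (w (tmin t (grid i.+1)) - w (tmin t (grid i)))).
Proof.
elim: k => [|k IH]; first by rewrite big_ord0 addr0.
by rewrite [LHS]extendE IH -addrA big_ord_recr.
Qed.

Lemma polygon_past zeta w B S k m t : (k <= m)%N ->
  set_val t <= set_val (grid k) ->
  polygon zeta w B S m t = polygon zeta w B S k t.
Proof.
move=> km tk; rewrite -(stop_polygon _ _ _ _ km) stopE tmin_l//.
Qed.

End polygon.

Section euler.
Context {R : realType} (T : {posnum R}) (p : R) (d d' : nat).
Context (b : time T -> Cpath T d -> Pp p (Cpath T d) -> 'cV[R]_d).
Context (sigma : time T -> Cpath T d -> Pp p (Cpath T d) -> 'M[R]_(d, d')).
Context (h : R) (h_gt0 : 0 < h).
Local Notation grid := (grid T h).

(** The cells before the one of t contribute in full, the cell of t contributes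
    the increment from t_h to t, and the cells after t contribute nothing. *)
Lemma euler_polygon (P : Pp p (Cpath T d)) zeta (w : Cpath T d') x (t : time T) :
  euler b sigma h P zeta w x t =
  polygon h zeta w (fun i => b (grid i) x P) (fun i => sigma (grid i) x P)
    (steps T h) t.
Proof.
have /andP[t0 tT] := time_itv t.
set n := Num.truncn (set_val t / h).
have /andP[nt tn] : n%:R <= set_val t / h < n.+1%:R.
  by apply: truncn_itv; rewrite divr_ge0// ltW.
have gridle i : (i <= n)%N -> set_val (grid i) = i%:R * h.
  move=> i_n; rewrite grid_val//; apply/min_idPl/(le_trans _ tT).
  by rewrite -ler_pdivlMr//; apply: le_trans nt; rewrite ler_nat.
have tgrid i : (i <= n)%N -> tmin t (grid i) = grid i.
  move=> i_n; apply: tmin_r; rewrite gridle// -ler_pdivlMr//.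
  by apply: le_trans nt; rewrite ler_nat.
have t_next : set_val t <= set_val (grid n.+1).
  by rewrite grid_val// le_min tT andbT -ler_pdivrMr// ltW.
rewrite (@polygon_past _ _ _ _ _ _ _ _ _ _ n.+1)//; last first.
  rewrite /steps ltnS; apply: le_truncn.
  by rewrite ler_pM2r ?invr_gt0.
rewrite polygonE big_ord_recr /= (tmin_l t_next) tgrid// gridle//.
rewrite /euler -/n -!addrA; congr (zeta + _); rewrite addrA addrC.
congr (_ + _); apply: eq_bigr => i _.
have i_n := ltn_ord i.
rewrite !tgrid ?gridle//; try exact: ltnW.
by rewrite -mulrBl -natrB// subSnn mul1r.
Qed.

End euler.

(** * Estimates for one step of the scheme *)

Section coefficient_bounds.
Context {R : realType} (T : {posnum R}) (p : R) (p1 : 1 <= p) (k : nat).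
Context (V : normedModType R) (c : time T -> Cpath T k -> Pp p (Cpath T k) -> V).
Hypothesis c_lip : coef_stopped_lipschitz p1 c.

Lemma coef_stop_dist : exists2 L : R, 0 < L & forall t x y P Q (e : R),
  (Wasserstein (stop_law p1 t P) (stop_law p1 t Q) <= e%:E)%E ->
  `|c t x P - c t y Q| <= L * (mdist (stop t x) (stop t y) + e).
Proof.
have [L L0 [cbar cbarL cE]] := c_lip; exists L => // t x y P Q e We.
rewrite !cE -lee_fin; apply: le_trans (cbarL _ _ _ _ _ _) _.
rewrite subrr normr0 add0e EFinM EFinD; apply: lee_wpmul2l.
  by rewrite lee_fin ltW.
exact: leeD2l.
Qed.

(** This non-anticipation is what makes the scheme explicit. *)
Lemma coef_stop_eq t x y P Q : stop t x = stop t y ->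
  measure_eq (stop_law p1 t P) (stop_law p1 t Q) -> c t x P = c t y Q.
Proof.
have [L L0 cL] := coef_stop_dist; move=> xy PQ.
have := cL t x y P Q 0; rewrite Wasserstein_eq0// lexx xy mdistxx addr0 mulr0.
by move=> /(_ isT); rewrite normr_le0 subr_eq0 => /eqP.
Qed.

End coefficient_bounds.

Section scheme.
Context {R : realType} (T : {posnum R}) (p : R) (p1 : 1 <= p) (d d' : nat).
Context (b : time T -> Cpath T d -> Pp p (Cpath T d) -> 'cV[R]_d).
Context (sigma : time T -> Cpath T d -> Pp p (Cpath T d) -> 'M[R]_(d, d')).
Hypothesis b_lip : coef_stopped_lipschitz p1 b.
Hypothesis s_lip : coef_stopped_lipschitz p1 sigma.
Hypothesis s_bnd : coef_bounded sigma.
Context (h : R).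

Local Notation C := (Cpath T d).
Local Notation I := (input_space T d d').
Local Notation grid := (grid T h).

Definition step u v (P : Pp p C) (x : C) (z : I) : C :=
  extend u v x (b u x P) (sigma u x P) z.2.

(** The product of the variation of sigma and of the norm of w is not Lipschitz.
    This norm is at most c0 + r + q, with q the excess over r of the distance of z
    to z0; the variation of sigma is bounded by the Lipschitz estimate in front of
    c0 + r, and by 2 M in front of q. *)
Lemma step_dist : exists2 K : R, 0 <= K & forall z0 : I, exists2 c : R, 0 <= c &
  forall u v x x' P P' z z' (e r : R), 0 <= e -> 0 <= r ->
    (Wasserstein (stop_law p1 u P) (stop_law p1 u P') <= e%:E)%E ->
    mdist (step u v P x z) (step u v P' x' z') <=
      (c + K * r) * (mdist x x' + e) + K * mdist z z'
      + K * Num.max 0 (mdist z0 z - r).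
Proof.
have [Lb Lb0 bL] := coef_stop_dist b_lip.
have [Ls Ls0 sL] := coef_stop_dist s_lip.
have [M M0 sM] := s_bnd.
(* Increments of w are bounded by twice its norm, and the variation of sigma
   by 2 M, hence 2 and 4. *)
pose K := 2 * d'%:R * Ls + 4 * d'%:R * M.
have d0 : 0 <= d'%:R :> R by [].
have dLs : 0 <= d'%:R * Ls by rewrite mulr_ge0// ltW.
have dM : 0 <= d'%:R * M by rewrite mulr_ge0// ltW.
have T0 : 0 <= T%:num by [].
exists K => [|z0]; first by rewrite /K -!mulrA; lra.
pose c0 := mdist (z0.2 : Cpath T d') point.
have c00 : 0 <= c0 := mdist_ge0 _ _.
exists (1 + T%:num * Lb + K * c0) => [|u v x x' P P' z z' e r e0 r0 We].
  by rewrite !addr_ge0 ?mulr_ge0 ?(ltW Lb0)//; rewrite /K -!mulrA; lra.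
set a := mdist x x' + e.
have a0 : 0 <= a by rewrite addr_ge0// mdist_ge0.
set q := Num.max 0 _; set D := mdist z z'.
have q0 : 0 <= q by rewrite le_max lexx.
have D0 : 0 <= D := mdist_ge0 _ _.
have stopa : mdist (stop u x) (stop u x') + e <= a.
  by rewrite lerD2r; exact: mdist_stop.
have Ba : `|b u x P - b u x' P'| <= Lb * a.
  apply: le_trans (bL _ _ _ _ _ _ We) _.
  by rewrite ler_wpM2l// ltW.
have Sa : `|sigma u x P - sigma u x' P'| <= Ls * a.
  apply: le_trans (sL _ _ _ _ _ _ We) _.
  by rewrite ler_wpM2l// ltW.
have SM : `|sigma u x P - sigma u x' P'| <= 2 * M.
  apply: le_trans (ler_normB _ _) _; rewrite mulr_natl mulr2n.
  by rewrite lerD.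
have zD : mdist z.2 z'.2 <= D by rewrite /D mdist_prodE le_max lexx orbT.
have wc s : `|(z.2 : Cpath T d') s| <= c0 + r + q.
  have h1 : `|(z.2 : Cpath T d') s - (point : Cpath T d') s| <= mdist z.2 point.
    exact: path_mdist_le.
  rewrite subr0 in h1; apply: le_trans h1 _.
  have := metric_triangle z.2 z0.2 (point : Cpath T d'); rewrite -/c0.
  rewrite (metric_sym z.2 z0.2).
  have : mdist z0.2 z.2 <= mdist z0 z by rewrite mdist_prodE le_max lexx orbT.
  have : mdist z0 z - r <= q by rewrite le_max lexx orbT.
  lra.
apply: le_trans (mdist_extend _ _ _ _ _ _ _ _ _ wc) _.
set dS := `|sigma u x P - _| in Sa SM *.
have dS0 : 0 <= dS := normr_ge0 _.
have h1 : T%:num * `|b u x P - b u x' P'| <= T%:num * Lb * a.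
  by rewrite -mulrA ler_wpM2l.
have h2 : `|sigma u x' P'| * mdist z.2 z'.2 <= M * D.
  by rewrite ler_pM ?mdist_ge0.
have h3 : dS * (c0 + r + q) <= Ls * a * (c0 + r) + 2 * M * q.
  rewrite mulrDr; apply: lerD; first by rewrite ler_wpM2r// addr_ge0.
  by rewrite ler_wpM2r.
have h2' : 2 * d'%:R * `|sigma u x' P'| * mdist z.2 z'.2 <= 2 * (d'%:R * M) * D.
  rewrite -!mulrA ler_wpM2l// ler_wpM2l//.
have h3' : 2 * d'%:R * dS * (c0 + r + q) <=
    2 * (d'%:R * Ls) * (a * (c0 + r)) + 4 * (d'%:R * M) * q.
  rewrite -!mulrA (_ : 4 = 2 * 2); last by rewrite -natrM.
  rewrite -!mulrA -mulrDr ler_wpM2l//.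
  rewrite [leRHS](_ : _ = d'%:R * (Ls * a * (c0 + r) + 2 * M * q)); last by ring.
  by rewrite ler_wpM2l.
have acr0 : 0 <= a * (c0 + r) by rewrite mulr_ge0// addr_ge0.
have xa : mdist x x' <= a by rewrite lerDl.
have g1 : 0 <= d'%:R * M * (a * (c0 + r)) by rewrite mulr_ge0.
have g2 : 0 <= d'%:R * Ls * D by rewrite mulr_ge0.
have g3 : 0 <= d'%:R * M * D by rewrite mulr_ge0.
have g4 : 0 <= d'%:R * Ls * q by rewrite mulr_ge0.
apply: le_trans (lerD (lerD (lerD xa h1) h3') h2') _.
rewrite /K -subr_ge0.
rewrite [leRHS](_ : _ = 4 * (d'%:R * M * (a * (c0 + r))) +
  2 * (d'%:R * Ls * D) + 2 * (d'%:R * M * D) + 2 * (d'%:R * Ls * q)).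
  by rewrite !addr_ge0// mulr_ge0.
ring.
Qed.

End scheme.

(** * The solution as a function of the input and of its law *)

Section stages.
Context {R : realType} (T : {posnum R}) (p : R) (p1 : 1 <= p) (d d' : nat).
Context (b : time T -> Cpath T d -> Pp p (Cpath T d) -> 'cV[R]_d).
Context (sigma : time T -> Cpath T d -> Pp p (Cpath T d) -> 'M[R]_(d, d')).
Hypothesis b_lip : coef_stopped_lipschitz p1 b.
Hypothesis s_lip : coef_stopped_lipschitz p1 sigma.
Hypothesis s_bnd : coef_bounded sigma.
Context (h : R) (h_gt0 : 0 < h).

Local Notation C := (Cpath T d).
Local Notation I := (input_space T d d').
Local Notation grid := (grid T h).
Local Notation step := (step b sigma).

(** The case of equal laws, with truncation centred at z0 itself, where the
    excess vanishes. *)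
Lemma step_dist_fixed (z0 : I) : exists2 K : R, 0 <= K &
  forall u v P x x' z, mdist (step u v P x z0) (step u v P x' z) <=
    K * (mdist x x' + mdist z0 z).
Proof.
have [K K0 /(_ z0)[c c0 H]] := step_dist b_lip s_lip s_bnd.
exists (c + K) => [|u v P x x' z]; first exact: addr_ge0.
have := H u v x x' P P z0 z 0 0 (lexx _) (lexx _).
rewrite Wasserstein_eq0// lexx => /(_ isT) le1; apply: le_trans le1 _.
rewrite mdistxx subr0 maxxx !mulr0 !addr0 mulrDl !mulrDr.
have := mulr_ge0 c0 (mdist_ge0 z0 z); have := mulr_ge0 K0 (mdist_ge0 x x').
lra.
Qed.

Lemma step_continuous (G : I -> C) u v P : continuous G ->
  continuous (fun z => step u v P (G z) z).
Proof.
move=> /continuous_mdistP cG; apply/continuous_mdistP => z e e0.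
have [K K0 H] := step_dist_fixed z.
have e1 : 0 < e / (2 * (K + 1)) by rewrite divr_gt0// mulr_gt0// ltr_wpDl.
have [r r0 Gr] := cG z _ e1.
exists (Num.min r (e / (2 * (K + 1)))) => [|z']; first by rewrite lt_min r0 e1.
rewrite lt_min => /andP[/Gr G1 z1]; apply: le_lt_trans (H _ _ _ _ _ _) _.
apply: (@le_lt_trans _ _ ((K + 1) * (mdist (G z) (G z') + mdist z z'))).
  by rewrite ler_wpM2r ?addr_ge0 ?mdist_ge0// lerDl.
rewrite mulrC -ltr_pdivlMr ?ltr_wpDl//.
have -> : e / (K + 1) = e / (2 * (K + 1)) + e / (2 * (K + 1)).
  by field; rewrite gt_eqF// ltr_wpDl.
exact: ltrD.
Qed.

Lemma step_growth (G : I -> C) u v P : linear_growth G ->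
  linear_growth (fun z => step u v P (G z) z).
Proof.
move=> gG z0; have [c c0 Gc] := gG z0; have [K K0 H] := step_dist_fixed z0.
exists (K * (c + 1)) => [|z]; first by rewrite mulr_ge0// addr_ge0.
apply: le_trans (H _ _ _ _ _ _) _; rewrite -mulrA ler_wpM2l//.
rewrite mulrDl mul1r; apply: lerD; first exact: Gc.
by rewrite lerDr.
Qed.

Definition step_tame u v P (G : tame_map I C) : tame_map I C :=
  TameMap (@step_continuous G u v P (tame_continuous G))
    (step_growth u v P (tame_growth G)).

Definition start (z : I) : C := (cst z.1 : continuousType (time T) 'cV[R]_d).

Lemma mdist_start z z' : mdist (start z) (start z') <= mdist z z'.
Proof.
apply: path_mdist_ge => t; rewrite mdist_prodE le_max; apply/orP; left.
by rewrite mdist_mxE distrC.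
Qed.

Lemma start_growth : linear_growth start.
Proof.
move=> z0; exists 1 => // z; rewrite mul1r.
by apply: le_trans (mdist_start _ _) _; rewrite lerDr.
Qed.

Definition start_tame : tame_map I C :=
  TameMap (continuous_mdist_leP mdist_start) start_growth.

(** Stage k + 1 needs the law of stage k, which is the image of the input law mu
    by stage k: the recursion is on maps of the input and not on random variables,
    and so makes sense for every mu. *)
Fixpoint stage (mu : Pp p I) (k : nat) : tame_map I C :=
  if k is k.+1 then
    step_tame (grid k) (grid k.+1) (push p1 (stage mu k) mu) (stage mu k)
  else start_tame.

Definition stage_law mu k : Pp p C := push p1 (stage mu k) mu.

Lemma stage_polygon mu k z : stage mu k z =
  polygon h z.1 z.2 (fun i => b (grid i) (stage mu i z) (stage_law mu i))
    (fun i => sigma (grid i) (stage mu i z) (stage_law mu i)) k.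
Proof. by elim: k => // k IH /=; rewrite -IH. Qed.

Lemma stop_stage mu k j z : (k <= j)%N ->
  stop (grid k) (stage mu j z) = stage mu k z.
Proof. by move=> kj; rewrite !stage_polygon stop_polygon. Qed.

Lemma stop_stage_law mu i :
  measure_eq (stop_law p1 (grid i) (stage_law mu i)) (stage_law mu i).
Proof.
move=> A mA; change (mu (stage mu i @^-1` (stop (grid i) @^-1` A)) =
  mu (stage mu i @^-1` A)); congr (mu _).
by apply/funext => z /=; rewrite stop_stage.
Qed.

(** The law P is only known through its restrictions to the past, which have to
    be identified along the induction: by almost sure equality for the
    McKean-Vlasov equation, by images of empirical measures for the particles. *)
Lemma euler_stage (mu : Pp p I) z (P : Pp p C) (x : C) k : (k <= steps T h)%N ->
  (forall t, x t = euler b sigma h P z.1 z.2 x t) ->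
  (forall i, (i < k)%N ->
    measure_eq (stop_law p1 (grid i) P) (stage_law mu i)) ->
  stop (grid k) x = stage mu k z.
Proof.
move=> ks xE.
have xpoly : x = polygon h z.1 z.2 (fun i => b (grid i) x P)
    (fun i => sigma (grid i) x P) (steps T h).
  by apply/continuousEP => t; rewrite [LHS]xE euler_polygon.
elim/ltn_ind: k ks => k IH ks Pk.
rewrite {1}xpoly stop_polygon// stage_polygon.
have coef (V : normedModType R) (c : time T -> C -> Pp p C -> V) i : (i < k)%N ->
    coef_stopped_lipschitz p1 c ->
    c (grid i) x P = c (grid i) (stage mu i z) (stage_law mu i).
  move=> ik c_lip; apply: (coef_stop_eq c_lip).
    rewrite (IH i ik (leq_trans (ltnW ik) ks)) ?stop_stage// => j ji.
    exact: Pk (ltn_trans ji ik).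
  by move=> A mA; rewrite (Pk i ik A mA) stop_stage_law.
by apply: eq_polygon => i ik; exact: coef.
Qed.

Lemma stage_euler (mu : Pp p I) z (P : Pp p C) t :
  measure_eq P (stage_law mu (steps T h)) ->
  stage mu (steps T h) z t =
  euler b sigma h P z.1 z.2 (stage mu (steps T h) z) t.
Proof.
move=> PE; rewrite euler_polygon//.
suff {1}-> : stage mu (steps T h) z =
    polygon h z.1 z.2 (fun i => b (grid i) (stage mu (steps T h) z) P)
      (fun i => sigma (grid i) (stage mu (steps T h) z) P) (steps T h) by [].
have coef (V : normedModType R) (c : time T -> C -> Pp p C -> V) i :
    (i < steps T h)%N -> coef_stopped_lipschitz p1 c ->
    c (grid i) (stage mu i z) (stage_law mu i) =
    c (grid i) (stage mu (steps T h) z) P.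
  move=> ik c_lip; apply: (coef_stop_eq c_lip).
    by rewrite !stop_stage// ltnW.
  move=> A mA; rewrite stop_stage_law//.
  have mA' := preimage_measurable (@stop_continuous R T d (grid i)) mA.
  apply/esym; change (P (stop (grid i) @^-1` A) = mu (stage mu i @^-1` A)).
  rewrite PE//.
  change (mu (stage mu (steps T h) @^-1` (stop (grid i) @^-1` A)) =
    mu (stage mu i @^-1` A)); congr (mu _).
  apply/funext => y.
  change (A (stop (grid i) (stage mu (steps T h) y)) = A (stage mu i y)).
  by rewrite stop_stage// ltnW.
by rewrite {1}stage_polygon; apply: eq_polygon => i ik; exact: coef.
Qed.

Lemma stop_steps (x : C) : stop (grid (steps T h)) x = x.
Proof. by apply: stop_id; exact: grid_steps. Qed.

(** With t = T this says that stages depend on the values of mu on Borel sets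
    only.  If t is in the past of the k-th cell, the step adds nothing before t;
    otherwise the coefficients of the step only see the past of t, where the two
    recursions agree. *)
Lemma stage_causal (t : time T) (mu nu : Pp p I) k (z : I) :
  let S (y : I) : I := (y.1, stop t y.2) in
  (forall A : set (borel I), measurable A -> nu A = mu (S @^-1` A)) ->
  stop t (stage mu k z) = stop t (stage nu k (S z)).
Proof.
move=> S nuE; elim: k z => [|k IH] z; first by apply/continuousEP.
rewrite /= /step !stop_extend.
have -> : stop t (S z).2 = stop t z.2 by rewrite stop_stop tmin_l.
rewrite -IH; have [tu|ut] := leP (set_val t) (set_val (grid k)).
  have tv : set_val t <= set_val (grid k.+1).
    by apply: le_trans tu _; exact: grid_le.
  by rewrite !tmin_r// !extend_degenerate.
have coef (V : normedModType R) (c : time T -> C -> Pp p C -> V) :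
    coef_stopped_lipschitz p1 c ->
    c (grid k) (stage mu k z) (stage_law mu k) =
    c (grid k) (stage nu k (S z)) (stage_law nu k).
  have stopk (x : C) : stop (grid k) x = stop (grid k) (stop t x).
    by rewrite stop_stop tmin_l// ltW.
  move=> c_lip; apply: (coef_stop_eq c_lip).
    by rewrite stopk IH -stopk.
  move=> A mA.
  change (mu (stage mu k @^-1` (stop (grid k) @^-1` A)) =
    nu (stage nu k @^-1` (stop (grid k) @^-1` A))).
  rewrite nuE; last first.
    apply: (preimage_measurable (tame_continuous (stage nu k))).
    exact: (preimage_measurable (@stop_continuous R T d (grid k))).
  congr (mu _); apply/funext => y /=.
  by rewrite stopk IH -stopk.
by rewrite !coef.
Qed.

End stages.

(** * Stability of the stages under couplings *)

Section stability.
Context {R : realType} (T : {posnum R}) (p : R) (p1 : 1 <= p) (d d' : nat).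
Context (b : time T -> Cpath T d -> Pp p (Cpath T d) -> 'cV[R]_d).
Context (sigma : time T -> Cpath T d -> Pp p (Cpath T d) -> 'M[R]_(d, d')).
Hypothesis b_lip : coef_stopped_lipschitz p1 b.
Hypothesis s_lip : coef_stopped_lipschitz p1 sigma.
Hypothesis s_bnd : coef_bounded sigma.
Context (h : R).

Local Notation C := (Cpath T d).
Local Notation I := (input_space T d d').
Local Notation grid := (grid T h).
Local Notation step := (step b sigma).
Local Notation stage := (stage b_lip s_lip s_bnd h).
Local Notation stage_law := (stage_law b_lip s_lip s_bnd h).

Let p_ge0 : 0 <= p. Proof. exact: le_trans p1. Qed.

(** The order of the choices matters: the tail of mu fixes the truncation level
    r, which fixes the Lipschitz constant A of the step, and only then is the
    required smallness eta of the cost at stage k known. *)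
Lemma stage_cost (mu : Pp p I) k (e : R) : 0 < e ->
  exists2 delta : R, 0 < delta & forall (nu : Pp p I) g, couplings mu nu g ->
    (\int[g]_z (mdist z.1 z.2 `^ p)%:E < delta%:E)%E ->
    (\int[g]_z (mdist (stage mu k z.1) (stage nu k z.2) `^ p)%:E < e%:E)%E.
Proof.
elim: k e => [|k IH] e e0.
  exists e; first exact: e0.
  move=> nu g gP lt.
  apply: (le_lt_trans _ lt).
  apply: (@cost_le R p _ _ g (fun z => stage mu 0 z.1) (fun z => stage nu 0 z.2)).
  - exact: fst_continuous (tame_continuous (stage mu 0)).
  - exact: snd_continuous (tame_continuous (stage nu 0)).
  - exact: measurable_dist_powR.
  - move=> z; rewrite lee_fin; apply: ge0_ler_powR; rewrite ?nnegrE ?mdist_ge0//.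
    exact: mdist_start.
have [K K0 HK] := step_dist b_lip s_lip s_bnd.
pose Q : R := 2 `^ p * 2 `^ p; have Q0 : 0 <= Q by rewrite mulr_ge0 ?powR_ge0.
pose beta := Q * K `^ p.
have beta0 : 0 <= beta by rewrite mulr_ge0 ?powR_ge0.
have be0 : 0 < e / (4 * (beta + 1)) by rewrite divr_gt0// mulr_gt0// ltr_wpDl.
have [z0 [r r0 tail]] := tail_integral p1 mu be0.
have [c c0 {}HK] := HK z0; pose A := c + K * r.
have A0 : 0 <= A by rewrite addr_ge0// mulr_ge0.
pose alpha := Q * (A `^ p * 2 `^ p).
have alpha0 : 0 <= alpha by rewrite !mulr_ge0 ?powR_ge0.
pose eta := e / (4 * (alpha + 1)).
have eta0 : 0 < eta by rewrite divr_gt0// mulr_gt0// ltr_wpDl.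
have [delta delta0 Hd] := IH eta eta0.
exists (Num.min delta (e / (4 * (beta + 1)))) => [|nu g gP].
  by rewrite lt_min delta0.
rewrite EFin_min lt_min => /andP[/(Hd nu g gP) costk cost0].
(* The Wasserstein distance of the two laws is at most the p-cost of the
   current stages to the power 1/p, so that e' may serve as its bound. *)
pose e' := eta `^ p^-1.
have e'0 : 0 < e' by rewrite powR_gt0.
have e'p : e' `^ p = eta by rewrite root_powR// ltW.
have cmu := tame_continuous (stage mu k).
have cnu := tame_continuous (stage nu k).
have We : (Wasserstein (stop_law p1 (grid k) (stage_law mu k))
    (stop_law p1 (grid k) (stage_law nu k)) <= e'%:E)%E.
  apply/ltW; apply: (Wasserstein_push_lt p1 e'0 gP
    (compose_continuous cmu (@stop_continuous R T d (grid k)))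
    (compose_continuous cnu (@stop_continuous R T d (grid k)))) => //.
  rewrite e'p; apply: le_lt_trans costk.
  apply: (@cost_le R p _ _ g (fun z => stop (grid k) (stage mu k z.1))
    (fun z => stop (grid k) (stage nu k z.2))).
  - exact: fst_continuous (compose_continuous cmu (@stop_continuous R T d (grid k))).
  - exact: snd_continuous (compose_continuous cnu (@stop_continuous R T d (grid k))).
  - exact: measurable_cost (fst_continuous cmu) (snd_continuous cnu).
  - move=> z; rewrite lee_fin; apply: ge0_ler_powR; rewrite ?nnegrE ?mdist_ge0//.
    exact: mdist_stop.
pose f1 (z : I * I) := (mdist (stage mu k z.1) (stage nu k z.2) `^ p)%:E.
pose f2 (z : I * I) := (mdist z.1 z.2 `^ p)%:E.
pose f3 (z : I * I) := (Num.max 0 (mdist z0 z.1 - r) `^ p)%:E.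
have m1 : @measurable_fun _ _ (borel (I * I)%type) (\bar R) setT f1.
  exact: measurable_cost (fst_continuous cmu) (snd_continuous cnu).
have m2 : @measurable_fun _ _ (borel (I * I)%type) (\bar R) setT f2.
  exact: measurable_dist_powR.
have m3 : @measurable_fun _ _ (borel (I * I)%type) (\bar R) setT f3.
  apply: (measurableT_comp (measurable_tail p z0 r)).
  exact: continuous_measurable (fst_continuous (@id_continuous _ I)).
have f10 z : (0 <= f1 z)%E by rewrite lee_fin powR_ge0.
have f20 z : (0 <= f2 z)%E by rewrite lee_fin powR_ge0.
have f30 z : (0 <= f3 z)%E by rewrite lee_fin powR_ge0.
(* The p-th power of the one-step estimate, integrated term by term below. *)
pose w (z : I * I) :=
  (alpha%:E * (f1 z + eta%:E) + beta%:E * f2 z + beta%:E * f3 z)%E.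
apply: (@le_lt_trans _ _ (\int[g]_z w z)%E).
  apply: (@cost_le R p _ _ g (fun z => stage mu k.+1 z.1)
    (fun z => stage nu k.+1 z.2)).
  - exact: fst_continuous (tame_continuous (stage mu k.+1)).
  - exact: snd_continuous (tame_continuous (stage nu k.+1)).
  - apply: emeasurable_funD; last exact: emeasurable_funM.
    apply: emeasurable_funD; last exact: emeasurable_funM.
    by apply: emeasurable_funM => //; exact: emeasurable_funD.
  - move=> z; have := HK (grid k) (grid k.+1) (stage mu k z.1) (stage nu k z.2)
      (stage_law mu k) (stage_law nu k) z.1 z.2 e' r (ltW e'0) r0 We.
    set D := mdist (stage mu k z.1) _; set D0 := mdist z.1 z.2.
    set q := Num.max 0 _ => le1.
    have Dge : 0 <= D := mdist_ge0 _ _.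
    have D0ge : 0 <= D0 := mdist_ge0 _ _.
    have qge : 0 <= q by rewrite le_max lexx.
    rewrite /w /f1 /f2 /f3 -/D -/D0 -/q -!EFinD lee_fin.
    have De : 0 <= D + e' by rewrite addr_ge0// ltW.
    apply: (@le_trans _ _ ((A * (D + e') + K * D0 + K * q) `^ p)).
      apply: ge0_ler_powR; rewrite ?nnegrE ?mdist_ge0//.
      by rewrite addr_ge0 ?mulr_ge0// addr_ge0 ?mulr_ge0.
    apply: le_trans (powR3_le p1 _ _ _) _; rewrite ?mulr_ge0//.
    rewrite [leRHS](_ : _ = Q * (A `^ p * (2 `^ p * (D `^ p + eta)) +
      K `^ p * D0 `^ p + K `^ p * q `^ p)); last by rewrite /alpha /beta; ring.
    rewrite ler_wpM2l// powRM// [(K * D0) `^ p]powRM// [(K * q) `^ p]powRM//.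
    rewrite !lerD2r ler_wpM2l ?powR_ge0//.
    by rewrite -e'p; apply: powRD_le => //; exact: ltW.
have tail1 : (\int[g]_z f3 z < (e / (4 * (beta + 1)))%:E)%E.
  have ft0 (x : I) : (0 <= (Num.max 0 (mdist z0 x - r) `^ p)%:E)%E.
    by rewrite lee_fin powR_ge0.
  have fE := @coupling_integral_fst R I mu nu g _ gP (measurable_tail p z0 r) ft0.
  by rewrite fE.
apply: le_lt_trans (integral_affine_le alpha0 beta0 (ltW eta0) m1 m2 m3
  f10 f20 f30 (ltW costk) (ltW cost0) (ltW tail1)) _.
rewrite lte_fin.
have ea : (alpha + 1) * eta = e / 4 by rewrite /eta; field; rewrite gt_eqF// ltr_wpDl.
have eb : (beta + 1) * (e / (4 * (beta + 1))) = e / 4.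
  by field; rewrite gt_eqF// ltr_wpDl.
move: (e / (4 * (beta + 1))) be0 eb => y be0 eb; lra.
Qed.

End stability.

(** * Solutions of the two discretised equations *)

Lemma ae_eq_distribution (R : realType) d (Omega : measurableType d)
    (Pr : probability Omega R) d' (E : measurableType d')
    (U V : {mfun Omega >-> E}) (A : set E) :
  {ae Pr, forall omega, U omega = V omega} -> measurable A ->
  Pr (U @^-1` A) = Pr (V @^-1` A).
Proof.
move=> UV mA.
have mpre (X : {mfun Omega >-> E}) : measurable (X @^-1` A).
  by rewrite -[X in measurable X]setTI; exact: measurable_funP.
have le (X Y : {mfun Omega >-> E}) : {ae Pr, forall omega, X omega = Y omega} ->
    (Pr (X @^-1` A) <= Pr (Y @^-1` A))%E.
  move=> [N [mN PN sub]].
  apply: (@le_trans _ _ (Pr (Y @^-1` A `|` N))).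
    apply: le_measure; rewrite ?inE//; first exact: measurableU.
    move=> w Xw; have [XY|nXY] := pselect (X w = Y w).
      by left; rewrite /= -XY.
    by right; apply: sub.
  by rewrite measureU0.
by apply/eqP; rewrite eq_le !le//; apply: filterS UV => w ->.
Qed.

Section particles.
Context {R : realType} (T : {posnum R}) (p : R) (p1 : 1 <= p) (d d' : nat).
Context (b : time T -> Cpath T d -> Pp p (Cpath T d) -> 'cV[R]_d).
Context (sigma : time T -> Cpath T d -> Pp p (Cpath T d) -> 'M[R]_(d, d')).
Hypothesis b_lip : coef_stopped_lipschitz p1 b.
Hypothesis s_lip : coef_stopped_lipschitz p1 sigma.
Hypothesis s_bnd : coef_bounded sigma.
Context (h : R) (h_gt0 : 0 < h).

Local Notation C := (Cpath T d).
Local Notation I := (input_space T d d').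
Local Notation grid := (grid T h).
Local Notation K := (steps T h).
Local Notation stage := (stage b_lip s_lip s_bnd h).
Local Notation stage_law := (stage_law b_lip s_lip s_bnd h).

Let p_gt0 : 0 < p. Proof. exact: lt_le_trans p1. Qed.

Definition solution_law (mu : Pp p I) : Pp p C := stage_law mu K.

Lemma solution_law_continuous : Wasserstein_continuous solution_law.
Proof.
move=> mu e e0; have ep0 : 0 < e `^ p by rewrite powR_gt0.
have [delta delta0 H] := stage_cost b_lip s_lip s_bnd h mu K ep0.
exists (delta `^ p^-1) => [|nu]; first by rewrite powR_gt0.
move=> W; have dp0 : 0 < delta `^ p^-1 by rewrite powR_gt0.
have [g gP] := Wasserstein_lt_cost p1 dp0 W.
rewrite root_powR ?(ltW delta0)// => /(H nu g gP) cost.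
by apply: (Wasserstein_push_lt p1 e0 gP (tame_continuous (stage mu K))
  (tame_continuous (stage nu K)) _ _ cost).
Qed.

Section fixed_size.
Context (N : nat).
Implicit Types (z : 'rV[I]_N.+1) (x : 'I_N.+1 -> C).

Definition particle k (i : 'I_N.+1) z : C :=
  stage (empirical p (fun j => z 0 j)) k (z 0 i).

(** The number of particles being fixed, each term of an empirical cost is at most
    that number times the cost, so stability for couplings gives uniform closeness
    of the particles. *)
Lemma particle_continuous k i : continuous (particle k i).
Proof.
apply/continuous_mdistP => z e e0.
pose mu z : Pp p I := empirical p (fun j => z 0 j).
have N0 : 0 < N.+1%:R :> R by [].
have ep0 : 0 < e `^ p / N.+1%:R by rewrite divr_gt0// powR_gt0.
have [delta delta0 H] := stage_cost b_lip s_lip s_bnd h (mu z) k ep0.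
exists (delta `^ p^-1) => [|y zy]; first by rewrite powR_gt0.
have cpl := @empirical_coupling R p I N (fun j => z 0 j) (fun j => y 0 j).
have := H (mu y) _ cpl; rewrite !empirical_integral; last 4 first.
- apply: measurable_cost.
    exact: fst_continuous (tame_continuous (stage (mu z) k)).
  exact: snd_continuous (tame_continuous (stage (mu y) k)).
- by move=> w; rewrite lee_fin powR_ge0.
- exact: measurable_dist_powR.
- by move=> w; rewrite lee_fin powR_ge0.
rewrite !sumEFin -!EFinM !lte_fin => {}H.
have zyi j : mdist (z 0 j) (y 0 j) <= mdist z y.
  exact: (le_bigmax _ (fun ij : 'I_1 * 'I_N.+1 =>
    mdist (z ij.1 ij.2) (y ij.1 ij.2)) (0, j)).
have {H} : N.+1%:R^-1 * \sum_(j < N.+1)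
    mdist (stage (mu z) k (z 0 j)) (stage (mu y) k (y 0 j)) `^ p <
    e `^ p / N.+1%:R.
  apply: H; rewrite mulrC ltr_pdivrMr//.
  rewrite [ltRHS]mulr_natr -[X in _ *+ X]card_ord -sumr_const.
  apply: ltr_sum => [|j _]; first by apply/hasP; exists ord0; rewrite ?mem_index_enum.
  rewrite -[ltRHS](root_powR p1) ?(ltW delta0)//.
  apply: gt0_ltr_powR; rewrite ?nnegrE ?mdist_ge0 ?powR_ge0//.
  exact: le_lt_trans (zyi j) zy.
rewrite [ltRHS]mulrC ltr_pM2l ?invr_gt0// => sum_lt.
rewrite ltNge; apply/negP => ei; move: sum_lt; apply/negP; rewrite -leNgt.
rewrite (bigD1 i)//=; apply: ler_wpDr.
  by apply: sumr_ge0 => j _; exact: powR_ge0.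
by apply: ge0_ler_powR; rewrite ?nnegrE ?mdist_ge0// ltW.
Qed.

Lemma empirical_particle_law z x :
  (forall i, x i = particle K i z) ->
  measure_eq (empirical p x) (solution_law (empirical p (fun j => z 0 j))).
Proof. by move=> xE A _; exact: empirical_comp. Qed.

Lemma particle_euler z i t :
  particle K i z t = euler b sigma h (empirical p (fun j => particle K j z))
    (z 0 i).1 (z 0 i).2 (particle K i z) t.
Proof. exact: stage_euler (empirical_particle_law _). Qed.

Lemma particle_unique z x :
  (forall i t, x i t = euler b sigma h (empirical p x) (z 0 i).1 (z 0 i).2 (x i) t) ->
  forall i, x i = particle K i z.
Proof.
move=> xE; suff H k i : (k <= K)%N -> stop (grid k) (x i) = particle k i z.
  by move=> i; rewrite -[LHS](stop_steps h_gt0) H.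
elim/ltn_ind: k i => k IH i kK.
rewrite /particle; apply: (euler_stage h_gt0 kK (xE i)) => j jk A mA.
change (empirical p x (stop (grid j) @^-1` A) =
  empirical p (fun l => z 0 l) (stage (empirical p (fun l => z 0 l)) j @^-1` A)).
transitivity (empirical p (fun l => particle j l z) A).
  symmetry; apply: empirical_comp => l; rewrite IH//.
  exact: leq_trans (ltnW jk) kK.
exact: empirical_comp.
Qed.

Lemma particle_stop z i k t :
  stop t (particle k i z) =
  stop t (particle k i (map_mx (fun y : I => (y.1, stop t y.2)) z)).
Proof.
rewrite /particle mxE.
apply: (stage_causal b_lip s_lip s_bnd h_gt0) => A mA.
by apply: empirical_comp => j; rewrite mxE.
Qed.

End fixed_size.

Section random_input.
Context {disp : measure_display} {Omega : measurableType disp}.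
Context (Pr : probability Omega R).

Lemma particle_system_solvable N (Z : Lp Pr p 'rV[I]_N.+1) :
  exists X : 'I_N.+1 -> {mfun Omega >-> borel C},
    [/\ particle_solution b sigma h Z X, particle_strong Z X
      & forall Y : 'I_N.+1 -> {mfun Omega >-> borel C},
          particle_solution b sigma h Z Y ->
          {ae Pr, forall omega, forall i, X i omega = Y i omega}].
Proof.
pose X i : {mfun Omega >-> borel C} :=
  continuous_rv (@particle_continuous N K i) (Lp_rv Z).
exists X; split.
- by apply: aeW => omega i t; exact: particle_euler.
- move=> i t A mA; apply: sub_gen_smallest; left.
  exists ((fun z : 'rV[I]_N.+1 => stop t (particle K i z)) @^-1` A).
    exact: (preimage_measurable (compose_continuous (@particle_continuous N K i)
      (@stop_continuous R T d t))).
  rewrite setTI; apply/funext => omega.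
  by rewrite /preimage /mkset /= (particle_stop (Z omega)).
- move=> Y solY; apply: filterS solY => omega Yeq i.
  by rewrite (particle_unique Yeq).
Qed.

(** Once the stages before k are identified almost surely, so are the laws that
    enter the k-th step. *)
Lemma McKeanVlasov_stage (Z : Lp Pr p I) (X : Lp Pr p C) k : (k <= K)%N ->
  McKeanVlasov_solution b sigma h Z X ->
  {ae Pr, forall omega, stop (grid k) (X omega) = stage (law Z) k (Z omega)}.
Proof.
move=> + solX; elim/ltn_ind: k => k IH kK.
apply: filterS solX => omega Xeq; apply: (euler_stage h_gt0 kK Xeq) => j jk A mA.
change (Pr (X @^-1` (stop (grid j) @^-1` A)) =
  Pr (Z @^-1` (stage (law Z) j @^-1` A))).
pose Xj : {mfun Omega >-> borel C} :=
  continuous_rv (@stop_continuous R T d (grid j)) (Lp_rv X).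
pose Zj : {mfun Omega >-> borel C} :=
  continuous_rv (tame_continuous (stage (law Z) j)) (Lp_rv Z).
apply: (@ae_eq_distribution _ _ _ Pr _ _ Xj Zj A) => //.
exact: IH (leq_trans (ltnW jk) kK).
Qed.

Lemma McKeanVlasov_unique (Z : Lp Pr p I) (X : Lp Pr p C) :
  McKeanVlasov_solution b sigma h Z X ->
  {ae Pr, forall omega, X omega = stage (law Z) K (Z omega)}.
Proof.
move=> /(McKeanVlasov_stage (leqnn K)); apply: filterS => omega <-.
by rewrite stop_steps.
Qed.

Lemma McKeanVlasov_law (Z : Lp Pr p I) (X : Lp Pr p C) :
  McKeanVlasov_solution b sigma h Z X ->
  measure_eq (law X) (solution_law (law Z)).
Proof.
move=> solX A mA.
pose ZK : {mfun Omega >-> borel C} :=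
  continuous_rv (tame_continuous (stage (law Z) K)) (Lp_rv Z).
apply: (@ae_eq_distribution _ _ _ Pr _ _ X ZK A) => //.
exact: McKeanVlasov_unique.
Qed.

Lemma McKeanVlasov_solvable (Z : Lp Pr p I) :
  exists2 X : Lp Pr p C, McKeanVlasov_solution b sigma h Z X
  & forall Y : Lp Pr p C, McKeanVlasov_solution b sigma h Z Y ->
      {ae Pr, forall omega, X omega = Y omega}.
Proof.
pose ZK : {mfun Omega >-> borel C} :=
  continuous_rv (tame_continuous (stage (law Z) K)) (Lp_rv Z).
have ZKp : finite_moment p (distribution Pr ZK).
  apply: (@tame_moment R p p1 _ _ (stage (law Z) K) _ _ Pr (Lp_rv Z) ZK) => //.
  exact: Lp_moment.
exists (MkLp ZKp) => [|Y solY].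
  by apply: aeW => omega t; exact: stage_euler.
by apply: filterS (McKeanVlasov_unique solY) => omega ->.
Qed.

End random_input.

End particles.

Theorem theorem2p4 (R : realType) (T : {posnum R}) (d d' : nat)
  (hd : (0 < d)%N) (hd' : (0 < d')%N) (p : R) (hp : 1 <= p)
  (b : time T -> Cpath T d -> Pp p (Cpath T d) -> 'cV[R]_d)
  (sigma : time T -> Cpath T d -> Pp p (Cpath T d) -> 'M[R]_(d, d'))
  (b_continuous : coef_continuous b)
  (sigma_continuous : coef_continuous sigma)
  (b_lipschitz : coef_stopped_lipschitz hp b)
  (sigma_lipschitz : coef_stopped_lipschitz hp sigma)
  (sigma_bounded : coef_bounded sigma)
  (h : R) (h_gt0 : 0 < h)
  (disp : measure_display) (Omega : measurableType disp)
  (Pr : probability Omega R) :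
  [/\ (forall (N : nat) (Z : Lp Pr p 'rV[input_space T d d']_N.+1),
         exists X : 'I_N.+1 -> {mfun Omega >-> borel (Cpath T d)},
           [/\ particle_solution b sigma h Z X,
               particle_strong Z X
             & forall Y : 'I_N.+1 -> {mfun Omega >-> borel (Cpath T d)},
                 particle_solution b sigma h Z Y ->
                 {ae Pr, forall omega, forall i, X i omega = Y i omega}]),
      (forall Z : Lp Pr p (input_space T d d'),
         exists2 X : Lp Pr p (Cpath T d),
           McKeanVlasov_solution b sigma h Z X
         & forall Y : Lp Pr p (Cpath T d),
             McKeanVlasov_solution b sigma h Z Y ->
             {ae Pr, forall omega, X omega = Y omega})
    & exists Psi : Pp p (input_space T d d') -> Pp p (Cpath T d),
        [/\ solution_law_map b sigma h Psi,
            Wasserstein_continuous Psi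
          & forall (N : nat) (Z : Lp Pr p 'rV[input_space T d d']_N.+1)
              (X : 'I_N.+1 -> {mfun Omega >-> borel (Cpath T d)}),
              particle_solution b sigma h Z X ->
              {ae Pr, forall omega,
                 measure_eq
                   (empirical p (fun i => X i omega : Cpath T d))
                   (Psi (empirical p
                      (fun i => (Z omega : 'rV[input_space T d d']_N.+1) 0 i)))}]].
Proof.
split.
- move=> N Z.
  exact: (particle_system_solvable b_lipschitz sigma_lipschitz sigma_bounded h_gt0).
- move=> Z.
  exact: (McKeanVlasov_solvable b_lipschitz sigma_lipschitz sigma_bounded h_gt0).
- exists (solution_law b_lipschitz sigma_lipschitz sigma_bounded h); split.
  + move=> disp' Omega' Pr' Z X; exact: McKeanVlasov_law.
  + exact: solution_law_continuous.
  + move=> N Z X solX; apply: filterS solX => omega Xeq.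
    by apply: empirical_particle_law; exact: particle_unique.
Qed.
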